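(* Let $H:\mathbb{R}^d\times\mathbb{R}^d\to\mathbb{R}$, $(p,x)\mapsto H(p,x)$, be convex and Lipschitz continuous in $p$, with Lipschitz constant $L$ (uniformly in $x$), and satisfy the standing assumptions listed in the context. Then, for all $T>0$ and all continuous $\xi:[0,T]\to\mathbb{R}$ with $\xi(0)=0$, $$\rho_H(\xi,T)\le L\,\|R_{0,T}(\xi)\|_{TV([0,T])}.$$
   Context: $BUC(\mathbb{R}^d)$ is the space of bounded uniformly continuous real functions on $\mathbb{R}^d$; $B_R(x)$ is the ball of radius $R$ centred at $x$; $\xi_{s,t}:=\xi(t)-\xi(s)$; $\|\zeta\|_{TV([a,b])}=\sup_{a=t_0\le\dots\le t_n=b}\sum_i|\zeta(t_{i+1})-\zeta(t_i)|\in[0,\infty]$ is the total variation. Standing assumption 1 (well-posedness). For each sign and every $u_0\in BUC(\mathbb{R}^d)$ the problem $u_t=\pm H(Du,x)$ in $\mathbb{R}^d\times(0,\infty)$, $u(\cdot,0)=u_0$, has a unique viscosity solution that is bounded and uniformly continuous on $\mathbb{R}^d\times[0,T]$ for every $T>0$. For $t\ge0$ write $S_{\pm H}(t)u_0:=u(\cdot,t)$, and for $t\le 0$ write $S_H(t):=S_{-H}(-t)$. Let $\ell(v,x)=\sup_{p\in\mathbb{R}^d}\{p\cdot v-H(p,x)\}\in(-\infty,+\infty]$ and, for $t>0$, let the minimal action be $$\mathcal{L}(x,y,t)=\inf\Big\{\int_0^t \ell(\dot\gamma(s),\gamma(s))\,ds:\ \gamma:[0,t]\to\mathbb{R}^d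 \text{ Lipschitz},\ \gamma(0)=x,\ \gamma(t)=y\Big\}.$$ It is recalled (classical) that $S_H(t)u_0(x)=\sup_{y}[u_0(y)-\mathcal{L}(x,y,t)]$ and $S_{-H}(t)u_0(x)=\inf_{y}[u_0(y)+\mathcal{L}(y,x,t)]$ for $t>0$. Standing assumption 2. Either $H$ does not depend on $x$, or both of the following hold: for all $r>0$, $\limsup_{\delta\to0}\inf_{|x-y|\ge r}\mathcal{L}(x,y,\delta)=+\infty$; and $\lim_{\delta\to0}\lim_{r\to0}\sup_{|x-y|\le r}\mathcal{L}(x,y,\delta)=0$. Solution flow. If $\xi$ is continuous and affine on each interval of a partition $0=t_0\le\dots\le t_N=T$, put $S_H^\xi(0,T):=S_H(\xi_{t_{N-1},t_N})\circ\dots\circ S_H(\xi_{t_0,t_1})$. For general continuous $\xi$, $S_H^\xi(0,T)u_0:=\lim_n S_H^{\xi^n}(0,T)u_0$ (uniform limit on $\mathbb{R}^d$) for any continuous piecewise linear $\xi^n\to\xi$ uniformly on $[0,T]$; under the standing assumptions the limit exists and does not depend on the sequence. The solution of $du=H(Du,x)\cdot d\xi$ with $u(\cdot,0)=u_0\in BUC(\mathbb{R}^d)$ is $u(\cdot,t)=S_H^\xi(0,t)u_0$. Range of dependence. $\rho_H(\xi,T)$ is the supremum of all $R\ge0$ for which there exist solutions $u^1,u^2$ of $du=H(Du,x)\cdot d\xi$ and $x\in\mathbb{R}^d$ such that $u^1(\cdot,0)=u^2(\cdot,0)$ in $B_R(x)$ and $u^1(x,T)\ne u^2(x,T)$ (with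 $\sup\emptyset=0$). Reduced path. For continuous $\xi:[0,T]\to\mathbb{R}$ with $\xi(0)=0$ let $\tau_0:=\sup\{t\in[0,T]:\xi(t)=\max_{[0,T]}\xi \text{ or } \xi(t)=\min_{[0,T]}\xi\}$. Say $\tau_0$ is of maximum type if $\xi(\tau_0)=\max_{[0,T]}\xi$ and of minimum type if $\xi(\tau_0)=\min_{[0,T]}\xi$ (either choice if $\xi$ is constant). For $i\ge0$: if $\tau_i$ is of minimum type, $\tau_{i+1}:=\sup\arg\max_{[\tau_i,T]}\xi$, which is of maximum type; if $\tau_i$ is of maximum type, $\tau_{i+1}:=\sup\arg\min_{[\tau_i,T]}\xi$, which is of minimum type. For $i\le0$: if $\tau_i$ is of minimum type, $\tau_{i-1}:=\inf\arg\max_{[0,\tau_i]}\xi$, which is of maximum type; if $\tau_i$ is of maximum type, $\tau_{i-1}:=\inf\arg\min_{[0,\tau_i]}\xi$, which is of minimum type. Here $\arg\max_{[a,b]}\xi$, $\arg\min_{[a,b]}\xi$ are the sets of maximum and minimum points of $\xi$ on $[a,b]$. The reduced path $R_{0,T}(\xi)$ is the continuous path on $[0,T]$ that equals $\xi$ at $0$, at $T$ and at every $\tau_i$, $i\in\mathbb{Z}$, and is affine on each $[\tau_i,\tau_{i+1}]$. *)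

(* Defs.v *)
From HB Require Import structures.
From mathcomp Require Import all_boot all_order all_algebra.
From mathcomp Require Import all_classical all_reals all_analysis.
Set Implicit Arguments.
Unset Strict Implicit.
Unset Printing Implicit Defensive.
Import Order.TTheory GRing.Theory Num.Theory.
Import numFieldNormedType.Exports.
Local Open Scope classical_set_scope.
Local Open Scope ring_scope.

(* The norm that the library puts on 'rV[R]_d is the sup norm.  Its topology is
   the Euclidean one, but metric notions (Lipschitz constants, balls) have to be
   stated with the Euclidean norm enorm below. *)
Section Euclidean.
Context {R : realType} {d : nat}.
Implicit Types u v : 'rV[R]_d.

Definition dotp u v : R := \sum_(i < d) u 0 i * v 0 i.
Definition enorm u : R := Num.sqrt (dotp u u).

End Euclidean.

Section HamiltonJacobi.
Context {R : realType} {d : nat}.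
Notation E := 'rV[R]_d.
Notation hamiltonian := (E -> E -> R). (* H p x *)
Implicit Types (H F : hamiltonian) (u : E * R -> R).

Definition negH H : hamiltonian := fun p x => - H p x.

Definition convex_in_p H := forall x p q (a : R), 0 <= a <= 1 ->
  H (a *: p + (1 - a) *: q) x <= a * H p x + (1 - a) * H q x.

Definition lipschitz_in_p (L : R) H :=
  forall x p q, `|H p x - H q x| <= L * enorm (p - q).

Definition BUC (u0 : E -> R) :=
  (exists M : R, forall x, `|u0 x| <= M) /\
  (forall e : R, 0 < e -> exists2 r : R, 0 < r &
     forall x y, enorm (x - y) < r -> `|u0 x - u0 y| < e).

Definition BUC_strip (T : R) u :=
  (exists M : R, forall x t, 0 <= t <= T -> `|u (x, t)| <= M) /\
  (forall e : R, 0 < e -> exists2 r : R, 0 < r &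
     forall x y s t, 0 <= s <= T -> 0 <= t <= T ->
       enorm (x - y) < r -> `|s - t| < r -> `|u (x, s) - u (y, t)| < e).

(* C^1 on R^d x (0, oo): Frechet differentiable with continuous derivative. *)
Definition test_function (phi : E * R -> R) := forall z : E * R, 0 < z.2 ->
  differentiable phi z /\
  forall h : E * R, {for z, continuous (fun w => 'D_h phi w)}.

Definition Dx (phi : E * R -> R) (z : E * R) : E :=
  \row_i 'D_((delta_mx 0 i : E), (0 : R)) phi z.
Definition Dt (phi : E * R -> R) (z : E * R) : R := 'D_((0 : E), (1 : R)) phi z.

(* Viscosity solutions of u_t = F(Du, x) in R^d x (0, oo). *)
Definition viscosity_subsolution F u := forall phi, test_function phi ->
  forall z : E * R, 0 < z.2 ->
    (\forall w \near z, u w - phi w <= u z - phi z) ->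
    Dt phi z <= F (Dx phi z) z.1.

Definition viscosity_supersolution F u := forall phi, test_function phi ->
  forall z : E * R, 0 < z.2 ->
    (\forall w \near z, u z - phi z <= u w - phi w) ->
    F (Dx phi z) z.1 <= Dt phi z.

Definition hj_solution F (u0 : E -> R) u :=
  [/\ forall T, 0 < T -> BUC_strip T u,
      forall x, u (x, 0) = u0 x,
      viscosity_subsolution F u &
      viscosity_supersolution F u].

(* The values of u at negative times are irrelevant, hence uniqueness is only
   meant on R^d x [0, oo). *)
Definition well_posed F := forall u0 : E -> R, BUC u0 ->
  exists2 u, hj_solution F u0 u &
    forall u', hj_solution F u0 u' -> forall x t, 0 <= t -> u' (x, t) = u (x, t).

Definition the_hj_solution F (u0 : E -> R) : E * R -> R :=
  xget (fun=> 0) [set u | hj_solution F u0 u].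

Definition hjS H (t : R) (u0 : E -> R) : E -> R := fun x =>
  if 0 <= t then the_hj_solution H u0 (x, t)
  else the_hj_solution (negH H) u0 (x, - t).

Definition lagrangian H (v x : E) : \bar R :=
  ereal_sup [set (dotp p v - H p x)%:E | p in [set: E]].

Definition lipschitz_curve (t : R) (g : R -> E) := exists K : R,
  forall s s', 0 <= s <= t -> 0 <= s' <= t -> enorm (g s - g s') <= K * `|s - s'|.

(* Coordinatewise derivative; it is meaningful almost everywhere on [0, t] when
   g is Lipschitz. *)
Definition velocity (g : R -> E) (s : R) : E :=
  \row_i derive1 (fun r : R => g r 0 i) s.

Definition action H (t : R) (g : R -> E) : \bar R :=
  (\int[lebesgue_measure]_(s in `[0%R, t]) lagrangian H (velocity g s) (g s))%E.

Definition min_action H (x y : E) (t : R) : \bar R :=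
  ereal_inf [set action H t g | g in
    [set g : R -> E | [/\ lipschitz_curve t g, g 0 = x & g t = y]]].

(* The classical representation of the viscosity solution operators as value
   functions.  It is kept as a property of H because no regularity of H in x is
   prescribed from which it could be derived. *)
Definition control_representation H := forall u0 : E -> R, BUC u0 ->
  forall (t : R), 0 < t -> forall x : E,
    (hjS H t u0 x)%:E =
      ereal_sup [set ((u0 y)%:E - min_action H x y t)%E | y in [set: E]] /\
    (hjS (negH H) t u0 x)%:E =
      ereal_inf [set ((u0 y)%:E + min_action H y x t)%E | y in [set: E]].

Definition x_independent H := forall p x y, H p x = H p y.

Definition inf_action_far H (r t : R) : \bar R :=
  ereal_inf [set min_action H z.1 z.2 t | z in
    [set z : E * E | r <= enorm (z.1 - z.2)]].

Definition sup_action_near H (r t : R) : \bar R :=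
  ereal_sup [set min_action H z.1 z.2 t | z in
    [set z : E * E | enorm (z.1 - z.2) <= r]].

Definition action_assumption H :=
  x_independent H \/
  (forall r : R, 0 < r ->
     limf_esup (fun t => inf_action_far H r t) (0 : R)^'+ = +oo%E) /\
  ((fun t => lim (sup_action_near H r t @[r --> (0 : R)^'+])) @ (0 : R)^'+
     --> 0%E).

Definition affine_on (f : R -> R) (a b : R) := forall t, a <= t <= b ->
  (b - a) * f t = (b - t) * f a + (t - a) * f b.

Definition partition_of (t : R) (s : seq R) : bool :=
  path <=%R 0 s && (last 0 s == t).

Fixpoint affine_along (f : R -> R) (a : R) (s : seq R) : Prop :=
  if s is b :: s' then affine_on f a b /\ affine_along f b s' else True.

Fixpoint pl_flow H (f : R -> R) (a : R) (s : seq R) (u0 : E -> R) : E -> R :=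
  if s is b :: s' then pl_flow H f b s' (hjS H (f b - f a) u0) else u0.

(* v = S_H^xi(0, t) u0.  The approximations are automatically continuous on
   [0, t], being affine on each closed interval of a partition. *)
Definition is_flow H (xi : R -> R) (t : R) (u0 v : E -> R) :=
  forall (xin : nat -> R -> R) (s : nat -> seq R),
    (forall n, partition_of t (s n) /\ affine_along (xin n) 0 (s n)) ->
    {uniform `[0, t], xin @ \oo --> xi} ->
    {uniform, (fun n => pl_flow H (xin n) 0 (s n) u0) @ \oo --> v}.

Definition rough_solution H (xi : R -> R) (T : R) u :=
  BUC (fun x => u (x, 0)) /\
  forall t, 0 <= t <= T ->
    is_flow H xi t (fun x => u (x, 0)) (fun x => u (x, t)).

(* 0 is added to the set because sup of the empty set is 0 here, whereas it is
   -oo for ereal_sup. *)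
Definition range_of_dependence H (xi : R -> R) (T : R) : \bar R :=
  ereal_sup (0%E |` [set r%:E | r in
    [set r : R | 0 <= r /\ exists u1 u2 (x : E),
      [/\ rough_solution H xi T u1, rough_solution H xi T u2,
          (forall y, enorm (y - x) < r -> u1 (y, 0) = u2 (y, 0)) &
          u1 (x, T) <> u2 (x, T)]]]).

End HamiltonJacobi.

Section ReducedPath.
Context {R : realType}.
Implicit Types (xi f : R -> R) (a b T : R).

Definition argmax xi a b : set R :=
  [set t | a <= t <= b /\ forall s, a <= s <= b -> xi s <= xi t].
Definition argmin xi a b : set R :=
  [set t | a <= t <= b /\ forall s, a <= s <= b -> xi t <= xi s].

(* maxt i says that tau i is of maximum type; when xi is constant, maxt 0 may
   take either value. *)
Definition reduction_times xi T (tau : int -> R) (maxt : int -> bool) :=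
  [/\ tau 0 = sup (argmax xi 0 T `|` argmin xi 0 T),
      (if maxt 0 then argmax xi 0 T else argmin xi 0 T) (tau 0),
      (forall i : int, 0 <= i -> maxt (i + 1) = ~~ maxt i /\
         tau (i + 1) = sup (if maxt i then argmin xi (tau i) T
                            else argmax xi (tau i) T)) &
      (forall i : int, i <= 0 -> maxt (i - 1) = ~~ maxt i /\
         tau (i - 1) = inf (if maxt i then argmin xi 0 (tau i)
                            else argmax xi 0 (tau i)))].

(* The tau i may accumulate at an interior point of [0, T]; xi is then constant
   from 0 to that point (resp. from that point to T).  The intended path is constant
   there too, but any continuous f with the right end values is admitted. *)
Definition is_reduced_path xi T f := exists tau maxt,
  [/\ reduction_times xi T tau maxt,
      {within `[0, T], continuous f},
      f 0 = xi 0 /\ f T = xi T &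
      forall i : int, f (tau i) = xi (tau i) /\
                      affine_on f (tau i) (tau (i + 1))].

End ReducedPath.

(* Main.v *)
Require Import Defs.
From HB Require Import structures.
From mathcomp Require Import all_boot all_order all_algebra.
From mathcomp Require Import all_classical all_reals all_analysis.
From mathcomp Require Import ring lra.
Set Implicit Arguments.
Unset Strict Implicit.
Unset Printing Implicit Defensive.
Import Order.TTheory GRing.Theory Num.Theory.
Import numFieldNormedType.Exports.
Local Open Scope classical_set_scope.
Local Open Scope ring_scope.

(** Let S(t) be the solution operator of u_t = H(Du, x), with S(-t) that of
    u_t = - H(Du, x).  Each S(t) is monotone, S is a semigroup in each time
    direction separately, and the control representations give

      S(t) S(-t) <= Id <= S(-t) S(t)   for t >= 0

    (evaluate the inner extremum at the outer point).  These three facts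
    already cancel the inner oscillations of a driving path.  If the path f stays below its
    final value, then S(f(end) - f(t)) u(t) is nonincreasing in t; if it stays
    above its initial value, then u(t) - S(f(t) - f(0)) u(0) remains
    nonnegative.  So along a path that starts at its minimum and ends at its
    maximum the flow is the single operator S(f(end) - f(0))
    (flow_along_increasing), and likewise with minimum and maximum exchanged,
    by passing to S(-t) and the opposite order (flow_along_sandwich).

    Between tau_i and tau_{i+1} the path xi stays between its values at these
    two times.  It also stays between xi(tau_i) and xi(tau_{i+1}) on the whole
    of [tau_i, T] if i >= 0, and on the whole of [0, tau_{i+1}] if i < 0
    (reduction_times_forward, reduction_times_backward).  As the tau_i are
    monotone and bounded, some step tau_{N+1} - tau_N is so short that xi
    hardly moves after tau_N, nor, symmetrically, before some tau_{-M}.  An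
    interpolation of xi that is fine between tau_{-M} and tau_N, and has just
    one piece on each of [0, tau_{-M}] and [tau_N, T], is therefore uniformly
    close to xi, while its flow is a finite product of operators S whose times
    are increments of the reduced path (reduction_reducible).

    Finally, S(t) propagates at speed at most L.  Indeed the Lagrangian is +oo
    at velocities longer than L, and a Lipschitz curve that covers a distance
    greater than L t in time t is faster than L on a set of positive measure,
    so its action is +oo (min_action_pinfty).  This uses that a Lipschitz
    function is almost everywhere differentiable and is the integral of its
    derivative (lipschitz_FTC).  Hence the range of dependence of the finite
    product, and then of its limit, is at most L times the total variation of
    the reduced path. *)

(** * Lipschitz functions are integrals of their derivative *)

Section Stieltjes.
Context {R : realType}.
Local Notation mu := (@lebesgue_measure R).

(** Both measures are infima over the same countable covers by half-open
    intervals, on which the comparison is the hypothesis.  Thus the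
    Stieltjes measure of a Lipschitz function is absolutely continuous. *)
Lemma stieltjes_le_lebesgue (G : cumulative R R) (C : R) : 0 < C ->
  (forall x y, x <= y -> G y - G x <= C * (y - x)) ->
  forall A : set (measurableTypeR R),
    (lebesgue_stieltjes_measure G A <= C%:E * mu A)%E.
Proof.
move=> C0 GC A; rewrite /lebesgue_measure /lebesgue_stieltjes_measure.
rewrite /measure_extension /= /mu_ext -ereal_inf_pZl//.
apply/ereal_infP => _ [_ [F [mF AF] <-] <-].
apply: ge_ereal_inf; eexists; first by exists F.
rewrite -nneseriesZl; last by move=> *; exact: wlength_ge0.
apply: lee_nneseries => [i _ _|i _]; first exact: wlength_ge0.
have [a ab <-] := mF i.
rewrite !wlength_itv /= lte_fin; case: ifPn => [lt|_]; last by rewrite mule0.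
by rewrite -!EFinB -EFinM lee_fin GC// ltW.
Qed.

(** The density is the Radon-Nikodym derivative of the Stieltjes measure of
    G, restricted to ]0, t] to make it finite. *)
Lemma nondecreasing_lipschitz_density (G : R -> R) (C t : R) : 0 < C -> 0 < t ->
  (forall x y, x <= y -> 0 <= G y - G x <= C * (y - x)) ->
  exists h : R -> R, mu.-integrable setT (EFin \o h) /\
    forall y, 0 <= y <= t -> \int[mu]_(x in `]0, y]) h x = G y - G 0.
Proof.
move=> C0 t0 HG.
have ndG : nondecreasing G.
  by move=> x y xy; rewrite -subr_ge0; have /andP[] := HG _ _ xy.
have cG : continuous G.
  move=> x; apply/cvgrPdist_le => e e0; near=> y.
  have H : `|x - y| <= e / C.
    by near: y; apply: cvgr_dist_le; [exact: cvg_id|rewrite divr_gt0].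
  have {}H : C * `|x - y| <= e by rewrite mulrC -ler_pdivlMr.
  apply: le_trans H.
  have [xy|/ltW xy] := leP x y; have /andP[H0 H1] := HG _ _ xy.
    by rewrite distrC (distrC x) !ger0_norm// subr_ge0.
  by rewrite !ger0_norm// subr_ge0.
have rcG : right_continuous G by exact: right_continuousW.
pose cumG := isCumulative.Build R _ R G ndG rcG.
pose Gc : cumulative R R := HB.pack G cumG.
pose nu0 := lebesgue_stieltjes_measure Gc.
have mD : measurable (`]0, t]%classic : set (measurableTypeR R)).
  exact: measurable_itv.
have nuitv a b : a <= b -> nu0 `]a, b]%classic = (G b - G a)%:E.
  move=> ab; rewrite /nu0 /lebesgue_stieltjes_measure /measure_extension /=.
  have -> : mu_ext (wlength G) `]a, b] = wlength G `]a, b]%classic.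
    by apply: (@measurable_mu_extE _ _ _ (wlength Gc)); exists (a, b).
  by rewrite wlength_itv_bnd.
have nuD : (nu0 `]0%R, t]%classic < +oo)%E by rewrite nuitv ?ltW// ltry.
pose nu : {finite_measure set (measurableTypeR R) -> \bar R} := mfrestr mD nuD.
have numu : nu `<< mu.
  move=> N N0 A mA AN.
  rewrite /nu /= /mfrestr /mrestr; apply/eqP; rewrite eq_le measure_ge0 andbT.
  have := @stieltjes_le_lebesgue Gc C C0 _ (A `&` `]0, t]%classic).
  rewrite N0; last 2 first.
  - exact: measurableI.
  - by move=> x [/AN].
  by rewrite mule0; apply => x y /HG /andP[].
have [f [f0 ff intf fE]] := radon_nikodym_sigma_finite numu.
exists (fine \o f).
have fK : EFin \o (fine \o f) = f by apply/funext => x /=; rewrite fineK.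
rewrite fK; split => // y /andP[y0 yt].
have myD : measurable (`]0, y]%classic : set (measurableTypeR R)).
  exact: measurable_itv.
apply: EFin_inj.
rewrite /Rintegral.
rewrite (eq_integral f); last by move=> x _ /=; rewrite fineK.
rewrite -fE// /nu/= /mfrestr /mrestr setIidl; last first.
  by move=> x /=; rewrite !in_itv/= => /andP[-> /le_trans->].
by rewrite -[X in fine X]/(nu0 `]0, y]%classic) nuitv.
Unshelve. all: by end_near. Qed.

Lemma clamp_lipschitz (t x y : R) : 0 <= t -> x <= y ->
  let c z := Num.max 0 (Num.min z t) in 0 <= c x <= t /\ 0 <= c y - c x <= y - x.
Proof.
move=> t0 xy c; rewrite /c /Num.max /Num.min.
by do ! case: ifPn; rewrite -?leNgt; lra.
Qed.


Lemma lebesgue_measure_itv0 (t : R) : 0 < t -> mu `]0, t[%classic = t%:E.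
Proof. by move=> t0; rewrite lebesgue_measure_itv/= lte_fin t0 -EFinB subr0. Qed.

Lemma integrable_cst_itv0 (t C : R) : 0 < t ->
  mu.-integrable `]0, t[ (EFin \o cst C).
Proof.
move=> t0; rewrite (_ : _ \o _ = cst C%:E)//.
have mI : measurable (`]0, t[%classic : set (measurableTypeR R)).
  exact: measurable_itv.
apply/integrableP; split; first exact: measurable_cst.
by rewrite integral_cst//= lebesgue_measure_itv0// -EFinM ltry.
Qed.

(** Adding C x, for C at least the Lipschitz constant, makes g nondecreasing,
    so that it has a density; at the Lebesgue points of the density the first
    fundamental theorem of calculus gives the derivative.  Clamping the
    argument to [0, t] turns g into a function that is Lipschitz on the whole
    line. *)
Lemma lipschitz_FTC (g : R -> R) (K t : R) : 0 < t ->
  (forall x y : R, 0 <= x <= t -> 0 <= y <= t -> `|g x - g y| <= K * `|x - y|) ->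
  exists h : R -> R, [/\ mu.-integrable `]0, t[ (EFin \o h),
    \int[mu]_(x in `]0, t[) h x = g t - g 0 &
    {ae mu, forall x, 0 < x < t -> is_derive x 1 g (h x)}].
Proof.
move=> t0 gK; pose C : R := `|K| + 1; pose c z : R := Num.max 0 (Num.min z t).
have C0 : 0 < C by rewrite ltr_wpDl.
have cE (z : R) : 0 <= z <= t -> c z = z.
  move=> /andP[z0 zt]; rewrite /c /Num.max /Num.min.
  by do ! case: ifPn; rewrite -?leNgt; lra.
have HG x y : x <= y ->
    0 <= (g (c y) + C * y) - (g (c x) + C * x) <= 2 * C * (y - x).
  move=> xy; have [] := clamp_lipschitz (ltW t0) xy; rewrite -!/(c _) => cxt cxy.
  have cyt : 0 <= c y <= t by case: (clamp_lipschitz (ltW t0) (lexx y)).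
  have : `|g (c y) - g (c x)| <= C * (y - x).
    apply: le_trans (gK _ _ cyt cxt) _; case/andP: cxy => cxy0 cxy.
    rewrite (ger0_norm cxy0).
    apply: (@le_trans _ _ (C * (c y - c x))); last by rewrite ler_pM2l.
    by rewrite ler_wpM2r// /C (le_trans (ler_norm _))// lerDl.
  by rewrite ler_norml => /andP[]; lra.
have C20 : 0 < 2 * C by rewrite mulr_gt0.
have [h [ih hE]] := @nondecreasing_lipschitz_density _ _ _ C20 t0 HG.
have mI (i : interval R) : measurable ([set` i] : set (measurableTypeR R)).
  exact: measurable_itv.
have ihI (i : interval R) : mu.-integrable [set` i] (EFin \o h).
  by apply: integrableS ih => //; exact: mI.
have icI := integrable_cst_itv0 C t0.
exists (fun x => h x - C); split.
- by have := integrableB (mI _) (ihI `]0, t[) icI.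
- rewrite RintegralB//; try exact: mI.
  have -> : \int[mu]_(x in `]0, t[) h x = g t - g 0 + C * t.
    rewrite (Rintegral_itv_bndo_bndc (ihI `]0, t[)) hE ?cE ?lexx ?ltW//=.
    lra.
  rewrite (@Rintegral_cst _ _ _ mu `]0%R, t[%classic (mI _)).
  rewrite [X in fine X](_ : _ = t%:E); last exact: lebesgue_measure_itv0.
  by rewrite /= addrK.
- have := @FTC1 R h (BRight 0) (fun y => ihI _) (open_integrable_locally openT ih).
  apply: filterS; first exact: (ae_filter_ringOfSetsType mu).
  move=> x /= H /andP[x0 xt].
  have [] := H _; first by rewrite lte_fin.
  move=> dF /esym; rewrite !derive1E => FE.
  set F := (F in derivable F) in dF FE.
  have isF : is_derive x 1 F (h x) by rewrite FE; exact: derivableP.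
  have isG : is_derive x 1 (F - (C *: id) + cst (g 0)) (h x - C + 0).
    apply: is_deriveD; apply: is_deriveB.
    by rewrite -[X in is_derive _ _ _ X](mulr1 C); apply: is_deriveZ.
  rewrite -[X in is_derive _ _ _ X]addr0.
  apply: near_eq_is_derive isG.
  near=> y.
  have y0t : 0 <= y <= t.
    apply/andP; split; apply: ltW; near: y; first exact: lt_nbhsr.
    exact: lt_nbhsl.
  transitivity (F y - C * y + g 0); first by [].
  by rewrite /F hE// (cE y y0t) (cE 0) ?lexx ?(ltW t0)//; ring.
Unshelve. all: by end_near. Qed.

End Stieltjes.

(** * Euclidean norm *)

Section EuclideanNorm.
Context {R : realType} {d : nat}.
Implicit Types u v w : 'rV[R]_d.

Lemma dotpC u v : dotp u v = dotp v u.
Proof. by apply: eq_bigr => i _; rewrite mulrC. Qed.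

Lemma dotpDl u v w : dotp (u + v) w = dotp u w + dotp v w.
Proof. by rewrite /dotp -big_split; apply: eq_bigr => i _; rewrite mxE mulrDl. Qed.

Lemma dotpZl a u w : dotp (a *: u) w = a * dotp u w.
Proof. by rewrite /dotp mulr_sumr; apply: eq_bigr => i _; rewrite mxE mulrA. Qed.

Lemma dotpZr a u w : dotp u (a *: w) = a * dotp u w.
Proof. by rewrite dotpC dotpZl dotpC. Qed.

Lemma dotp0l u : dotp 0 u = 0.
Proof. by apply: big1 => i _; rewrite mxE mul0r. Qed.

Lemma dotpDr u v w : dotp w (u + v) = dotp w u + dotp w v.
Proof. by rewrite dotpC dotpDl !(dotpC w). Qed.

Lemma dotp_ge0 u : 0 <= dotp u u.
Proof. by apply: sumr_ge0 => i _; rewrite -expr2 sqr_ge0. Qed.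

Lemma enorm_ge0 u : 0 <= enorm u. Proof. exact: sqrtr_ge0. Qed.

Lemma sqr_enorm u : enorm u ^+ 2 = dotp u u.
Proof. by rewrite sqr_sqrtr// dotp_ge0. Qed.

Lemma enormZ a u : enorm (a *: u) = `|a| * enorm u.
Proof.
rewrite /enorm dotpZl dotpZr mulrA -expr2 sqrtrM ?sqr_ge0//.
by rewrite sqrtr_sqr.
Qed.

Lemma enormN u : enorm (- u) = enorm u.
Proof. by rewrite -scaleN1r enormZ normrN1 mul1r. Qed.

Lemma enorm0 : enorm (0 : 'rV[R]_d) = 0.
Proof. by rewrite /enorm dotp0l sqrtr0. Qed.

Lemma dotp_eq0 u : dotp u u = 0 -> u = 0.
Proof.
move=> /eqP; rewrite psumr_eq0; last by move=> i _; rewrite -expr2 sqr_ge0.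
move=> /allP u0; apply/rowP => i; rewrite mxE; apply/eqP.
by have := u0 i (mem_index_enum _); rewrite mulf_eq0 orbb.
Qed.

Lemma cauchy_schwarz u v : dotp u v <= enorm u * enorm v.
Proof.
have [v0|v0] := eqVneq (enorm v) 0.
  have -> : v = 0 by apply: dotp_eq0; rewrite -sqr_enorm v0 expr0n.
  by rewrite dotpC dotp0l mulr_ge0 ?enorm_ge0.
have : 0 <= dotp (enorm v *: u - enorm u *: v) (enorm v *: u - enorm u *: v).
  exact: dotp_ge0.
rewrite -scaleNr !(dotpDl, dotpDr, dotpZl, dotpZr) (dotpC v u) -!sqr_enorm.
have {}v0 : 0 < enorm v by rewrite lt_neqAle eq_sym v0 enorm_ge0.
have [u0|u0] := eqVneq (enorm u) 0.
  have -> : u = 0 by apply: dotp_eq0; rewrite -sqr_enorm u0 expr0n.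
  by rewrite dotp0l mulr_ge0 ?enorm_ge0.
have {}u0 : 0 < enorm u by rewrite lt_neqAle eq_sym u0 enorm_ge0.
rewrite (_ : _ + _ = 2 * (enorm u * enorm v) * (enorm u * enorm v - dotp u v)).
  by rewrite pmulr_rge0 ?subr_ge0// ?mulr_gt0.
ring.
Qed.

Lemma enormD u v : enorm (u + v) <= enorm u + enorm v.
Proof.
rewrite -(ler_pXn2r (n := 2)) ?nnegrE ?addr_ge0 ?enorm_ge0//.
rewrite sqr_enorm dotpDl !dotpDr (dotpC v u) -!sqr_enorm.
have := cauchy_schwarz u v; lra.
Qed.

Lemma abs_coord_le_enorm u i : `|u 0 i| <= enorm u.
Proof.
rewrite -(ler_pXn2r (n := 2)) ?nnegrE ?enorm_ge0// sqr_enorm real_normK ?num_real//.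
rewrite /dotp (bigD1 i)//= -expr2 lerDl.
by apply: sumr_ge0 => j _; rewrite -expr2 sqr_ge0.
Qed.

End EuclideanNorm.

(** * Curves faster than the Lipschitz constant have infinite action *)

Section Integral.
Context {disp} {T : measurableType disp} {R : realType}.
Variable mu : {measure set T -> \bar R}.

Import HBNNSimple.

(** Nothing is known about the measurability of f, which will be a Lagrangian
    along a curve.  The integral is then still the difference of the suprema
    of the simple integrals below its positive and negative parts, and the
    second of these is finite when the integral is not -oo, as oo - oo is
    -oo. *)
Lemma integral_pinfty_subset (f : T -> \bar R) (D A : set T) :
  measurable A -> A `<=` D -> (0 < mu A)%E -> (forall x, A x -> f x = +oo%E) ->
  (-oo < \int[mu]_(x in D) f x)%E -> (\int[mu]_(x in D) f x = +oo)%E.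
Proof.
move=> mA AD muA fA; rewrite /integral.
set P := ereal_sup _; set N := ereal_sup _.
have -> : P = +oo%E.
  apply/eqyP => M M0.
  have [r [r0 rA]] : exists r : R, 0 < r /\ (r%:E <= mu A)%E.
    case: (mu A) muA => [a|_|]//.
      by rewrite lte_fin => a0; exists a.
    by exists 1; rewrite leey.
  have s0 : 0 <= M / r by rewrite divr_ge0// ltW.
  pose h : {nnsfun T >-> R} := scale_nnsfun (indic_nnsfun R mA) s0.
  apply: (@le_trans _ _ (sintegral mu h)); last first.
    apply: ereal_sup_ubound; exists h => // x.
    have -> : h x = M / r * (x \in A)%:R by rewrite -(indicE _ A x).
    rewrite funeposE /patch; case: ifPn => [|/negP xD].
      rewrite inE => xD; have [xA|xA] := boolP (x \in A).
        by move: xA; rewrite inE => /fA ->; rewrite maxye leey.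
      by rewrite mulr0 le_max lexx orbT.
    rewrite memNset ?mulr0 ?le_max ?lexx ?orbT// => /AD xD'.
    by apply: xD; rewrite inE.
  rewrite (eq_sintegral (cst (M / r) \* indic_nnsfun R mA)%R)//.
  rewrite sintegralrM (eq_sintegral \1_A)// sintegral_indic//.
  apply: (@le_trans _ _ ((M / r)%:E * r%:E)%E).
    by rewrite -EFinM divfK// gt_eqF.
  by rewrite lee_pmul// ?lee_fin// ltW.
by case: N.
Qed.

End Integral.

Section FiniteSpeed.
Context {R : realType} {d : nat}.
Notation E := 'rV[R]_d.
Local Notation mu := (@lebesgue_measure R).
Variable (H : E -> E -> R) (L : R).
Hypotheses (L_ge0 : 0 <= L) (H_lipschitz : lipschitz_in_p L H).

(** Along p = c v, the function p . v - H(p, x) grows at least like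
    c |v| (|v| - L). *)
Lemma lagrangian_pinfty (v x : E) : L < enorm v -> lagrangian H v x = +oo%E.
Proof.
move=> Lv; apply/eqyP => M M0.
have v0 : 0 < enorm v by exact: le_lt_trans Lv.
pose c := Num.max 0 ((M + H 0 x) / (enorm v * (enorm v - L))).
have c0 : 0 <= c by rewrite le_max lexx.
apply: (@le_trans _ _ (dotp (c *: v) v - H (c *: v) x)%:E); last first.
  by apply: ereal_sup_ubound; exists (c *: v).
rewrite lee_fin dotpZl -sqr_enorm.
have := H_lipschitz x (c *: v) 0; rewrite subr0 enormZ (ger0_norm c0).
rewrite ler_norml => /andP[_].
have : M + H 0 x <= c * (enorm v * (enorm v - L)).
  by rewrite -ler_pdivrMr ?mulr_gt0 ?subr_gt0// le_max lexx orbT.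
nra.
Qed.

Lemma is_derive_dotp (g : R -> E) (e : E) (s : R) (h : 'I_d -> R) :
  (forall i, is_derive s 1 (fun r => g r 0 i) (h i)) ->
  is_derive s 1 (fun r => dotp e (g r)) (dotp e (velocity g s)).
Proof.
move=> hs.
have -> : dotp e (velocity g s) = \sum_(i < d) e 0 i *: h i.
  apply: eq_bigr => i _; rewrite mxE derive1E.
  by have /@derive_val -> := hs i.
have -> : (fun r => dotp e (g r)) = \sum_(i < d) (e 0 i *: (fun r : R => g r 0 i)).
  by apply/funext => r; rewrite fct_sumE.
by apply: is_derive_sum => i; apply: is_deriveZ.
Qed.

(** The component of the curve along e = g(t) - g(0) gains |e|^2, which
    exceeds L |e| t; so its derivative exceeds L |e| on a set of positive
    measure, and there Cauchy-Schwarz bounds the speed from below.  The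
    exceptional null set is removed to have a genuine velocity everywhere on
    A. *)
Lemma fast_curve_velocity (g : R -> E) (t : R) : 0 < t -> lipschitz_curve t g ->
  L * t < enorm (g t - g 0) ->
  exists A : set (measurableTypeR R), [/\ measurable A, A `<=` `[0, t]%classic,
    (0 < mu A)%E & forall s, A s -> L < enorm (velocity g s)].
Proof.
move=> t0 [K gK] far; set e := g t - g 0 in far.
have gi i (x y : R) : 0 <= x <= t -> 0 <= y <= t ->
    `|g x 0 i - g y 0 i| <= K * `|x - y|.
  move=> xt yt; apply: le_trans (gK _ _ xt yt).
  by have := abs_coord_le_enorm (g x - g y) i; rewrite !mxE.
have /choice[h hP] i := lipschitz_FTC t0 (gi i).
have ge (x y : R) : 0 <= x <= t -> 0 <= y <= t ->
    `|dotp e (g x) - dotp e (g y)| <= (enorm e * K) * `|x - y|.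
  move=> xt yt.
  rewrite -mulN1r -dotpZr scaleN1r -dotpDr.
  have gxy := gK _ _ xt yt.
  apply: (@le_trans _ _ (enorm e * enorm (g x - g y))); last first.
    by rewrite -mulrA ler_wpM2l ?enorm_ge0.
  rewrite ler_norml cauchy_schwarz andbT lerNl -mulN1r -dotpZl scaleN1r.
  by apply: le_trans (cauchy_schwarz _ _) _; rewrite enormN.
have [w [iw wE w']] := lipschitz_FTC t0 ge.
have {}wE : \int[mu]_(x in `]0, t[) w x = enorm e ^+ 2.
  by rewrite wE sqr_enorm -mulN1r -dotpZr scaleN1r -dotpDr.
have mI (i : interval R) : measurable ([set` i] : set (measurableTypeR R)).
  exact: measurable_itv.
have : {ae mu, forall s, 0 < s < t -> w s = dotp e (velocity g s)}.
  have h' : {ae mu, forall s i, 0 < s < t -> is_derive s 1 (fun r : R => g r 0 i) (h i s)}.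
    apply: (@filter_forall _ _ _ _ (ae_filter_ringOfSetsType mu)) => i.
    by case: (hP i).
  apply: (@filterS2 _ _ (ae_filter_ringOfSetsType mu) _ _ _ _ w' h') => s ws hs s0t.
  have /@derive_val <- := ws s0t.
  have /@derive_val <- := is_derive_dotp e (hs^~ s0t).
  by [].
move=> [N [mN N0 wN]].
pose A : set (measurableTypeR R) := `]0, t[ `&` [set s | ((L * enorm e)%:E < (w s)%:E)%E].
have mA : measurable A.
  apply: measurable_realfun.emeasurable_fun_o_infty; first exact: mI.
  by move/measurable_int : iw.
have e0 : 0 < enorm e by apply: le_lt_trans far; rewrite mulr_ge0// ltW.
have muA : (0 < mu A)%E.
  rewrite lt0e measure_ge0 andbT; apply/negP => /eqP A0.
  have : \int[mu]_(x in `]0, t[) w x <= L * enorm e * t.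
    rewrite /Rintegral (negligible_integral mA (mI _) iw A0) -/(Rintegral _ _ _).
    pose c := L * enorm e; have ic := integrable_cst_itv0 c t0.
    have mDA : measurable (`]0, t[ `\` A) by apply: measurableD => //; exact: mI.
    apply: (@le_trans _ _ (\int[mu]_(x in `]0, t[ `\` A) cst c x)).
      apply: le_Rintegral => //.
      - by apply: integrableS iw => //; exact: mI.
      - by apply: integrableS ic => //; exact: mI.
      - move=> s [s0t nA]; rewrite leNgt; apply/negP => ws; apply: nA.
        by split => //=; rewrite lte_fin.
    rewrite /Rintegral -(negligible_integral mA (mI _) ic A0).
    rewrite -/(Rintegral _ _ _) (@Rintegral_cst _ _ _ mu `]0%R, t[%classic (mI _)).
    by rewrite [X in fine X](_ : _ = t%:E)//; exact: lebesgue_measure_itv0.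
  rewrite wE; apply/negP; rewrite -ltNge expr2 mulrAC ltr_pM2r//.
exists (A `\` N); split.
- exact: measurableD.
- by move=> s [[+ _] _] /=; rewrite !in_itv/= => /andP[/ltW-> /ltW->].
- have -> // : mu (A `\` N) = mu A.
  rewrite (measureDI mu mA mN) [X in (_ + X)%E](_ : _ = 0%E) ?adde0//.
  by apply: subset_measure0 N0; [exact: measurableI| |exact: subIsetr].
- move=> s [[/= s0t Lw] Ns].
  have : w s = dotp e (velocity g s).
    apply: contrapT => ws; apply: Ns; apply: wN => /= /(_ _)/ws; apply.
    by move: s0t; rewrite in_itv.
  move=> ws; move: Lw; rewrite lte_fin ws => /lt_le_trans/(_ (cauchy_schwarz _ _)).
  by rewrite mulrC ltr_pM2l.
Qed.

(** The lower bound -oo < min_action excludes the curves whose action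
    has an infinite negative part. *)
Lemma min_action_pinfty (x y : E) (t : R) : 0 < t -> L * t < enorm (y - x) ->
  (-oo < min_action H x y t)%E -> (min_action H x y t = +oo)%E.
Proof.
move=> t0 far fin; apply/eqP; rewrite eq_le leey /=.
apply/ereal_infP => _ [g [gK g0 gt] <-].
have [|A [mA At muA Av]] := fast_curve_velocity t0 gK; first by rewrite g0 gt.
rewrite (_ : action H t g = +oo)%E//; apply: (integral_pinfty_subset mA At muA).
  by move=> s /Av /lagrangian_pinfty.
apply: lt_le_trans fin _; apply: ereal_inf_lbound; by exists g.
Qed.

End FiniteSpeed.

(** * Time translation of viscosity solutions *)

Section TimeChange.
Context {R : realType}.

Definition pos_sqr (r : R) : R := Num.max 0 r ^+ 2.

(** The expansion of the square of the positive part at x has a remainder of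
    at most h^2, whatever the signs of x and x + h. *)
Lemma is_derive_pos_sqr (x : R) : is_derive x 1 pos_sqr (2 * Num.max 0 x).
Proof.
have H : h^-1 *: (pos_sqr (h *: 1 + x) - pos_sqr x) @[h --> (0 : R)^'] -->
    2 * Num.max 0 x.
  apply/cvgrPdist_le => e e0; near=> h.
  have h0 : h != 0 by near: h; exact: nbhs_dnbhs_neq.
  apply: (@le_trans _ _ `|h|); last by near: h; exact: dnbhs0_le.
  have -> : 2 * Num.max 0 x - h^-1 *: (pos_sqr (h *: 1 + x) - pos_sqr x) =
      h^-1 * (2 * Num.max 0 x * h - (pos_sqr (h + x) - pos_sqr x)).
    by rewrite /GRing.scale /= mulr1; field.
  rewrite normrM normfV ler_pdivrMl ?normr_gt0// -normrM -expr2.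
  rewrite [leRHS]ger0_norm ?sqr_ge0// ler_norml /pos_sqr /Num.max.
  by do ! case: ifPn; rewrite -?leNgt => *; nra.
apply: DeriveDef; first by apply/cvg_ex; eexists; exact: H.
exact/cvg_lim.
Unshelve. all: by end_near. Qed.

Lemma continuous_pos_part : continuous (fun x : R => Num.max 0 x).
Proof.
move=> x; apply: continuous_max => //; exact: cvg_cst.
Qed.

(** A C^1 substitute for the translation s - t that remains positive for all
    s >= 0: a test function composed with s - t would only be defined for
    s > t. *)
Definition time_change (t c s : R) : R := s - t + pos_sqr (t + c - s) / (2 * c).
Definition time_change' (t c s : R) : R := 1 - Num.max 0 (t + c - s) / c.

Lemma time_change_gt0 (t c s : R) : 0 < c -> 0 <= s -> 0 <= t -> 0 < time_change t c s.
Proof.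
move=> c0 s0 t0.
have -> : time_change t c s = ((s - t) * (2 * c) + pos_sqr (t + c - s)) / (2 * c).
  by rewrite /time_change; field; rewrite gt_eqF.
apply: divr_gt0; last by rewrite mulr_gt0.
rewrite /pos_sqr /Num.max; case: ifPn; rewrite -?leNgt => r0.
  rewrite (_ : _ + _ = (s - t) ^+ 2 + c ^+ 2); last by ring.
  by rewrite ltr_wpDl ?sqr_ge0// exprn_gt0.
by rewrite expr0n addr0 mulr_gt0 ?mulr_gt0//; lra.
Qed.

Lemma time_change_id (t c s : R) : t + c <= s -> time_change t c s = s - t.
Proof.
move=> tcs; rewrite /time_change /pos_sqr max_l; last by rewrite subr_le0.
by rewrite expr0n mul0r addr0.
Qed.

Lemma is_derive_time_change (t c s : R) : 0 < c ->
  is_derive s 1 (time_change t c) (time_change' t c s).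
Proof.
move=> c0.
have -> : time_change t c = (id - cst t) + (2 * c)^-1 *: (pos_sqr \o (cst (t + c) - id)).
  by apply/funext => r; rewrite /time_change /= mulrC.
have -> : time_change' t c s = 1 - 0 + (2 * c)^-1 *: ((2 * Num.max 0 (t + c - s)) * (0 - 1)).
  rewrite /time_change' /GRing.scale /=; field; by rewrite gt_eqF.
apply: is_deriveD; apply: is_deriveZ.
have D1 : is_derive s 1 (cst (t + c) - id : R -> R) (0 - 1) by apply: is_deriveB.
have D2 := is_derive_pos_sqr ((cst (t + c) - id : R -> R) s).
exact: (is_derive1_comp D2 D1).
Qed.

Lemma continuous_time_change' (t c : R) : continuous (time_change' t c).
Proof.
move=> s; apply: cvgB; first exact: cvg_cst.
apply: cvgM; last exact: cvg_cst.
apply: (@continuous_comp _ _ _ (fun s => t + c - s) (Num.max 0)).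
  apply: cvgB => //; exact: cvg_cst.
exact: continuous_pos_part.
Qed.

End TimeChange.

Section Shift.
Context {R : realType} {d : nat}.
Notation E := 'rV[R]_d.

Lemma is_diff_time_change (t c : R) (w : E * R) : 0 < c ->
  is_diff w (fun w : E * R => (w.1, time_change t c w.2))
    (fun h => (h.1, h.2 * time_change' t c w.2)).
Proof.
move=> c0; apply: is_diff_pair.
  have cfst : continuous (fst : E * R -> E) by move=> ?; exact: cvg_fst.
  by apply: DiffDef; [exact: linear_differentiable|rewrite diff_lin].
apply: (@is_diff_comp _ _ _ _ snd snd (time_change t c) (fun h => h * time_change' t c w.2)).
  have csnd : continuous (snd : E * R -> R) by move=> ?; exact: cvg_snd.
  by apply: DiffDef; [exact: linear_differentiable|rewrite diff_lin].
have D := is_derive_time_change t w.2 c0.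
have df : differentiable (time_change t c) w.2 by apply/derivable1_diffP; case: D.
apply: DiffDef => //; rewrite diff1E// derive1E; apply/funext => h /=.
by have /@derive_val -> := D.
Qed.

Lemma continuous_time_change_pair (t c : R) : 0 < c ->
  continuous (fun w : E * R => (w.1, time_change t c w.2)).
Proof.
move=> c0 w; apply: differentiable_continuous.
by case: (is_diff_time_change t w c0).
Qed.

Lemma snd_near_gt (w : E * R) (a : R) : a < w.2 -> \forall v \near w, a < v.2.
Proof.
have cs : (snd : E * R -> R) v @[v --> w] --> w.2 by exact: cvg_snd.
exact: cvgr_gt cs _.
Qed.

(** With c half the time of the contact point z, the time change is the
    translation by t near the translated point. *)
Lemma test_function_shift (phi : E * R -> R) (z : E * R) (t : R) :
  test_function phi -> 0 < z.2 -> 0 <= t ->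
  exists2 psi, test_function psi &
    \forall w \near (z.1, z.2 + t), psi w = phi (w.1, w.2 - t).
Proof.
move=> tphi z0 t0; pose c := z.2 / 2.
have c0 : 0 < c by rewrite divr_gt0.
pose Th (w : E * R) := (w.1, time_change t c w.2).
have Th0 (w : E * R) : 0 < w.2 -> 0 < (Th w).2.
  by move=> w0; apply: time_change_gt0 => //; exact: ltW.
exists (phi \o Th).
  have psidiff (w : E * R) : 0 < w.2 -> is_diff w (phi \o Th)
      ('d phi (Th w) \o (fun h => (h.1, h.2 * time_change' t c w.2))).
    move=> w0; apply: is_diff_comp; first exact: is_diff_time_change.
    by apply: DiffDef => //; case: (tphi _ (Th0 _ w0)).
  move=> w w0; split; first by case: (psidiff w w0).
  move=> h.
  (* linearity of the differential separates the factor depending on v *)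
  have DE (v : E * R) : 0 < v.2 -> 'D_h (phi \o Th) v =
      'D_(h.1, 0) phi (Th v) + time_change' t c v.2 * 'D_(0, h.2) phi (Th v).
    move=> v0; have [dv dvE] := psidiff v v0.
    have [dphi _] := tphi _ (Th0 _ v0).
    rewrite deriveE// dvE !deriveE//=.
    rewrite -[_ * _]/(_ *: _) -linearZ -linearD /=; congr ('d _ _ _).
    by congr (_, _); rewrite /= ?scaler0 ?addr0// add0r [RHS]mulrC.
  have w_pos : \forall v \near w, 0 < v.2.
    exact: (snd_near_gt w0).
  have cD k : {for w, continuous (fun v => 'D_k phi (Th v))}.
    apply: (@continuous_comp _ _ _ Th (fun v => 'D_k phi v)).
      exact: continuous_time_change_pair.
    by have [_] := tphi _ (Th0 _ w0); apply.
  rewrite /prop_for /continuous_at (DE w w0).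
  apply: cvg_trans.
    apply: near_eq_cvg.
    by near=> v; apply/esym/DE; near: v; exact: w_pos.
  apply: cvgD; first exact: cD.
  apply: cvgM; last exact: cD.
  apply: (@continuous_comp _ _ _ snd (time_change' t c)); first exact: cvg_snd.
  exact: continuous_time_change'.
near=> w => /=; rewrite /Th time_change_id//.
apply/ltW; near: w.
apply: (@snd_near_gt (z.1, z.2 + t)).
by rewrite addrC ltrD2r /c; lra.
Unshelve. all: by end_near. Qed.


Lemma near_time_shift (P : E * R -> Prop) (z : E * R) (t : R) :
  (\forall w \near z, P w) -> \forall w \near (z.1, z.2 + t), P (w.1, w.2 - t).
Proof.
move=> Pz.
have : (fun w : E * R => (w.1, w.2 - t)) w @[w --> (z.1, z.2 + t)] --> z.
  rewrite [X in _ --> X](_ : z = (z.1, z.2 + t - t)); last by rewrite addrK; case: (z).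
  have c1 : fst w @[w --> (z.1, z.2 + t)] --> z.1 by exact: cvg_fst.
  have c2 : (snd : E * R -> R) w @[w --> (z.1, z.2 + t)] --> z.2 + t by exact: cvg_snd.
  exact: (cvg_pair c1 (cvgB c2 (cvg_cst t))).
by move/(_ _ Pz).
Qed.

Lemma derive_time_shift (phi : E * R -> R) (z v : E * R) (t : R) :
  'D_v (fun w => phi (w.1, w.2 - t)) (z.1, z.2 + t) = 'D_v phi z.
Proof.
rewrite /derive.
rewrite (_ : (fun h : R => _) = fun h : R => h^-1 *: (phi (h *: v + z) - phi z))//.
by apply/funext => h; rewrite /= addrA !addrK; case: z.
Qed.

Lemma shift_touching (phi psi : E * R -> R) (z : E * R) (t : R) :
  (\forall w \near (z.1, z.2 + t), psi w = phi (w.1, w.2 - t)) ->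
  [/\ psi (z.1, z.2 + t) = phi z, Dt psi (z.1, z.2 + t) = Dt phi z &
      Dx psi (z.1, z.2 + t) = Dx phi z].
Proof.
move=> psiE; have D v : 'D_v psi (z.1, z.2 + t) = 'D_v phi z.
  by rewrite -(derive_time_shift phi z v t); exact: near_eq_derive.
split; last by apply/rowP => i; rewrite !mxE D.
  by rewrite (nbhs_singleton psiE)/= addrK; case: z {D psiE}.
exact: D.
Qed.

(** Being a viscosity solution is local at each contact point, so it suffices
    to translate test functions near that point. *)
Lemma hj_solution_shift (F : E -> E -> R) u0 u (t : R) :
  hj_solution F u0 u -> 0 <= t ->
  hj_solution F (fun x => u (x, t)) (fun z => u (z.1, z.2 + t)).
Proof.
move=> [uBUC u0E usub usup] t0; split.
- move=> T T0; have [[M uM] uc] := uBUC (T + t) (ltr_pwDl T0 t0); split.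
    exists M => x s /andP[s0 sT]; apply: uM => /=.
    by rewrite addr_ge0//= lerD2r.
  move=> e e0; have [r r0 rP] := uc e e0.
  exists r => // x y s s' /andP[s0 sT] /andP[s'0 s'T] xy ss'.
  apply: rP => //=; rewrite ?addr_ge0 ?lerD2r//.
  by rewrite opprD addrACA subrr addr0.
- by move=> x /=; rewrite add0r.
- move=> phi tphi z z0 touch.
  have [psi tpsi psiE] := test_function_shift tphi z0 t0.
  have [pz <- <-] := shift_touching psiE.
  apply: (usub psi tpsi (z.1, z.2 + t)); first by rewrite /= ltr_wpDr.
  have := near_time_shift t touch; apply: filterS2 psiE => w -> /=.
  by rewrite pz subrK; case: w.
- move=> phi tphi z z0 touch.
  have [psi tpsi psiE] := test_function_shift tphi z0 t0.
  have [pz <- <-] := shift_touching psiE.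
  apply: (usup psi tpsi (z.1, z.2 + t)); first by rewrite /= ltr_wpDr.
  have := near_time_shift t touch; apply: filterS2 psiE => w -> /=.
  by rewrite pz subrK; case: w.
Qed.

End Shift.

(** * The solution semigroup *)

Section Semigroup.
Context {R : realType} {d : nat}.
Notation E := 'rV[R]_d.
Variable F : E -> E -> R.
Hypothesis F_wp : well_posed F.

Lemma the_hj_solutionP u0 : BUC u0 -> hj_solution F u0 (the_hj_solution F u0).
Proof.
move=> /F_wp[u uP _].
by apply: (@xgetPex _ (fun=> 0) [set u | hj_solution F u0 u]); exists u.
Qed.

Lemma the_hj_solution_unique u0 u x t : BUC u0 -> hj_solution F u0 u -> 0 <= t ->
  u (x, t) = the_hj_solution F u0 (x, t).
Proof.
move=> u0B uP t0; have [v _ vuniq] := F_wp u0B.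
by rewrite (vuniq u)// (vuniq (the_hj_solution F u0))//; exact: the_hj_solutionP.
Qed.

Lemma the_hj_solution_BUC u0 t : BUC u0 -> 0 <= t ->
  BUC (fun x => the_hj_solution F u0 (x, t)).
Proof.
move=> u0B t0; have [uB _ _ _] := the_hj_solutionP u0B.
have tt : 0 <= t <= t + 1 by rewrite t0 lerDl ler01.
have [[M uM] uc] := uB (t + 1) (ltr_wpDl t0 ltr01).
split.
  by exists M => x; exact: uM tt.
move=> e e0; have [r r0 rP] := uc e e0; exists r => // x y xy.
by apply: rP => //; rewrite subrr normr0.
Qed.

Lemma the_hj_solution0 u0 x : BUC u0 -> the_hj_solution F u0 (x, 0) = u0 x.
Proof. by move=> /the_hj_solutionP[]. Qed.

(** By uniqueness, since the time translate of a solution is a solution. *)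
Lemma the_hj_solutionD u0 s t x : BUC u0 -> 0 <= s -> 0 <= t ->
  the_hj_solution F u0 (x, t + s) =
  the_hj_solution F (fun y => the_hj_solution F u0 (y, s)) (x, t).
Proof.
move=> u0B s0 t0.
have := the_hj_solution_unique x (the_hj_solution_BUC u0B s0)
          (hj_solution_shift (the_hj_solutionP u0B) s0) t0.
by [].
Qed.

End Semigroup.

(** * Cancellation of inner oscillations *)

(** The argument only sees an order le and a family S of operators; keeping
    them abstract lets the same proof serve for decreasing paths, through
    t |-> S (- t) and the opposite order. *)
Section AbstractFlow.
Context {R : realType} {T : Type}.
Variables (S : R -> T -> T) (B : T -> Prop).

Fixpoint flow_along (f : R -> R) (a : R) (s : seq R) (u : T) : T :=
  if s is b :: s' then flow_along f b s' (S (f b - f a) u) else u.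

Lemma flow_along_cat f a s s' u :
  flow_along f a (s ++ s') u = flow_along f (last a s) s' (flow_along f a s u).
Proof. by elim: s a u => //= b s IH a u. Qed.

Lemma eq_flow_along f g a s u : {in a :: s, f =1 g} ->
  flow_along f a s u = flow_along g a s u.
Proof.
elim: s a u => //= b s IH a u fg.
rewrite IH; last by move=> c cs; apply: fg; rewrite inE cs orbT.
by rewrite !fg ?inE ?eqxx ?orbT.
Qed.

Hypothesis SB : forall t u, B u -> B (S t u).

Lemma flow_along_B f a s u : B u -> B (flow_along f a s u).
Proof. by elim: s a u => //= b s IH a u Bu; apply: IH; exact: SB. Qed.

Variable le : T -> T -> Prop.
Hypotheses (le_refl : forall u, le u u)
  (le_trans : forall u v w, le u v -> le v w -> le u w)
  (le_anti : forall u v, le u v -> le v u -> u = v).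
Hypotheses (S0 : forall u, B u -> S 0 u = u)
  (SD : forall s t u, 0 <= s -> 0 <= t -> B u -> S t (S s u) = S (s + t) u)
  (S_mono : forall t u v, B u -> B v -> le u v -> le (S t u) (S t v))
  (S_down_up : forall t u, 0 <= t -> B u -> le (S t (S (- t) u)) u)
  (S_up_down : forall t u, 0 <= t -> B u -> le u (S (- t) (S t u))).

(** The left-hand side does not increase along the path: an upward step
    leaves it unchanged by the semigroup property, and a downward step of
    length h inserts S h (S (- h)) <= Id. *)
Lemma flow_along_le f a s u (m : R) : B u -> {in a :: s, forall c, f c <= m} ->
  le (S (m - f (last a s)) (flow_along f a s u)) (S (m - f a) u).
Proof.
elim: s a u => //= b s IH a u Bu fm.
have fam : f a <= m by apply: fm; rewrite inE eqxx.
have fbm : f b <= m by apply: fm; rewrite !inE eqxx orbT.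
apply: le_trans (IH b _ (SB _ Bu) _) _.
  by move=> c cs; apply: fm; rewrite inE cs orbT.
have [fab|/ltW fba] := leP (f a) (f b).
  rewrite SD ?subr_ge0// (_ : f b - f a + (m - f b) = m - f a)//; ring.
rewrite (_ : m - f b = (f a - f b) + (m - f a)); last by ring.
rewrite -SD ?subr_ge0//; last exact: SB.
apply: S_mono => //; first by do 2 apply: SB.
have -> : f b - f a = - (f a - f b) by rewrite opprB.
by apply: S_down_up => //; rewrite subr_ge0.
Qed.

(** The lower bound propagates: an upward step uses the semigroup property,
    and a downward step of length h uses Id <= S (- h) (S h). *)
Lemma flow_along_ge f a s u v (m : R) : B u -> B v ->
  {in a :: s, forall c, m <= f c} -> le (S (f a - m) v) u ->
  le (S (f (last a s) - m) v) (flow_along f a s u).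
Proof.
elim: s a u => //= b s IH a u Bu Bv fm vu.
have fam : m <= f a by apply: fm; rewrite inE eqxx.
have fbm : m <= f b by apply: fm; rewrite !inE eqxx orbT.
apply: IH => //; first exact: SB.
  by move=> c cs; apply: fm; rewrite inE cs orbT.
apply: le_trans (S_mono _ _ Bu vu); last exact: SB.
have [fab|/ltW fba] := leP (f a) (f b).
  rewrite SD ?subr_ge0// (_ : f a - m + (f b - f a) = f b - m)//; ring.
rewrite (_ : f a - m = (f b - m) + (f a - f b)); last by ring.
rewrite -(SD (s := f b - m) (t := f a - f b)) ?subr_ge0//.
have -> : f b - f a = - (f a - f b) by rewrite opprB.
by apply: S_up_down; rewrite ?subr_ge0//; exact: SB.
Qed.

Lemma flow_along_increasing f a s u : B u ->
  {in a :: s, forall c, f a <= f c <= f (last a s)} ->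
  flow_along f a s u = S (f (last a s) - f a) u.
Proof.
move=> Bu fs; apply: le_anti.
  have := @flow_along_le f a s u (f (last a s)) Bu.
  rewrite subrr S0; last exact: flow_along_B.
  by apply => c /fs/andP[].
apply: flow_along_ge => //; first by move=> c /fs/andP[].
by rewrite subrr S0.
Qed.

End AbstractFlow.

(** * Properties of the solution operators *)

Section SolutionOperators.
Context {R : realType} {d : nat}.
Notation E := 'rV[R]_d.
Variables (H : E -> E -> R).
Hypotheses (H_wp : well_posed H) (negH_wp : well_posed (negH H))
    (H_control : control_representation H).
Local Notation S := (hjS H).

Lemma hjS_pos t u : 0 <= t -> S t u = fun x => the_hj_solution H u (x, t).
Proof. by move=> t0; apply/funext => x; rewrite /hjS t0. Qed.

Lemma hjS0 u : BUC u -> S 0 u = u.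
Proof. by move=> Bu; rewrite hjS_pos//; apply/funext => x; rewrite the_hj_solution0. Qed.

Lemma hjS_neg t u : BUC u -> 0 <= t ->
  S (- t) u = fun x => the_hj_solution (negH H) u (x, t).
Proof.
move=> Bu t0; apply/funext => x; rewrite /hjS; case: ifPn; last by rewrite opprK.
rewrite oppr_ge0 => t0'; have -> : t = 0 by apply/eqP; rewrite eq_le t0' t0.
by rewrite oppr0 !the_hj_solution0.
Qed.

Lemma hjS_negH t u : BUC u -> 0 <= t -> S (- t) u = hjS (negH H) t u.
Proof. by move=> Bu t0; rewrite hjS_neg//; apply/funext => x; rewrite /hjS t0. Qed.

Lemma hjS_BUC t u : BUC u -> BUC (S t u).
Proof.
move=> Bu; have [t0|/ltW t0] := leP 0 t.
  by rewrite hjS_pos//; exact: the_hj_solution_BUC.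
by rewrite -(opprK t) hjS_neg ?oppr_ge0//; apply: the_hj_solution_BUC; rewrite ?oppr_ge0.
Qed.

Lemma hjSD s t u : 0 <= s -> 0 <= t -> BUC u -> S t (S s u) = S (s + t) u.
Proof.
move=> s0 t0 Bu; rewrite !hjS_pos ?addr_ge0//; apply/funext => x.
by rewrite addrC the_hj_solutionD.
Qed.

Lemma hjSD_neg s t u : 0 <= s -> 0 <= t -> BUC u -> S (- t) (S (- s) u) = S (- (s + t)) u.
Proof.
move=> s0 t0 Bu; rewrite !hjS_neg ?addr_ge0//; last exact: the_hj_solution_BUC.
by apply/funext => x; rewrite addrC the_hj_solutionD.
Qed.

Lemma hjS_ubound t u x y : BUC u -> 0 < t ->
  ((u y)%:E - min_action H x y t <= (S t u x)%:E)%E.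
Proof.
move=> Bu t0; have [-> _] := H_control Bu t0 x.
by apply: ereal_sup_ubound; exists y.
Qed.

Lemma hjS_lbound t u x y : BUC u -> 0 < t ->
  ((S (- t) u x)%:E <= (u y)%:E + min_action H y x t)%E.
Proof.
move=> Bu t0; rewrite (hjS_negH Bu (ltW t0)); have [_ ->] := H_control Bu t0 x.
by apply: ereal_inf_lbound; exists y.
Qed.

Lemma hjS_le t u x (m : \bar R) : BUC u -> 0 < t ->
  (forall y, (u y)%:E - min_action H x y t <= m)%E -> ((S t u x)%:E <= m)%E.
Proof.
move=> Bu t0 um; have [-> _] := H_control Bu t0 x.
by apply: ge_ereal_sup => _ [y _ <-].
Qed.

Lemma hjS_ge t u x (m : \bar R) : BUC u -> 0 < t ->
  (forall y, m <= (u y)%:E + min_action H y x t)%E -> (m <= (S (- t) u x)%:E)%E.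
Proof.
move=> Bu t0 um; rewrite (hjS_negH Bu (ltW t0)); have [_ ->] := H_control Bu t0 x.
by apply: le_ereal_inf_tmp => _ [y _ <-].
Qed.

Lemma BUC_cst (c : R) : BUC (fun _ : E => c).
Proof.
split; first by exists `|c|.
by move=> e e0; exists 1 => // x y _; rewrite subrr normr0.
Qed.

(** Otherwise the control formula would give an infinite value of the
    solution with zero initial data. *)
Lemma min_action_gtNy x y t : 0 < t -> (-oo < min_action H x y t)%E.
Proof.
move=> t0; have := hjS_ubound x y (BUC_cst 0) t0.
by case: (min_action H x y t) => // r _; rewrite ltNyr.
Qed.

Definition fun_le (u v : E -> R) := forall x, u x <= v x.

Lemma hjS_mono t u v : BUC u -> BUC v -> fun_le u v -> fun_le (S t u) (S t v).
Proof.
move=> Bu Bv uv x; rewrite -lee_fin.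
have [t0|t0|->] := ltgtP t 0; last by rewrite !hjS0// lee_fin.
  rewrite -(opprK t); apply: hjS_ge => //; first by rewrite oppr_gt0.
  move=> y; apply: le_trans (hjS_lbound _ y Bu _) _; first by rewrite oppr_gt0.
  by apply: leeD2r; rewrite lee_fin.
apply: hjS_le => // y; apply: le_trans (hjS_ubound x y Bv t0).
by apply: leeB => //; rewrite lee_fin.
Qed.

(** Evaluated at the point x, the inner infimum is at most u(x) plus the very
    action that the outer supremum subtracts. *)
Lemma hjS_down_up t u : 0 <= t -> BUC u -> fun_le (S t (S (- t) u)) u.
Proof.
rewrite le_eqVlt => /predU1P[<-|t0] Bu x; first by rewrite oppr0 !hjS0//; exact: hjS_BUC.
rewrite -lee_fin; apply: hjS_le => //; first exact: hjS_BUC.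
move=> y; have := hjS_lbound y x Bu t0.
have := min_action_gtNy x y t0.
case: (min_action H x y t) => [r _|_ _|//]; last by rewrite leNye.
by rewrite -?EFinD -?EFinB !lee_fin lerBlDr.
Qed.

Lemma hjS_up_down t u : 0 <= t -> BUC u -> fun_le u (S (- t) (S t u)).
Proof.
rewrite le_eqVlt => /predU1P[<-|t0] Bu x; first by rewrite oppr0 !hjS0//; exact: hjS_BUC.
rewrite -lee_fin; apply: hjS_ge => //; first exact: hjS_BUC.
move=> y; have := hjS_ubound y x Bu t0.
have := min_action_gtNy y x t0.
case: (min_action H y x t) => [r _|_ _|//]; last by rewrite leey.
by rewrite -?EFinD -?EFinB !lee_fin lerBlDr.
Qed.

Lemma pl_flowE f a s u : pl_flow H f a s u = flow_along S f a s u.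
Proof. by elim: s a u => //= b s IH a u; rewrite IH. Qed.

Lemma flow_along_negate f a s u :
  flow_along S f a s u = flow_along (fun t => S (- t)) (fun c => - f c) a s u.
Proof.
elim: s a u => //= b s IH a u; rewrite IH; congr (flow_along _ _ _ _ (S _ _)); ring.
Qed.

Lemma fun_le_anti u v : fun_le u v -> fun_le v u -> u = v.
Proof. by move=> uv vu; apply/funext => x; apply/eqP; rewrite eq_le uv vu. Qed.

Lemma fun_le_trans u v w : fun_le u v -> fun_le v w -> fun_le u w.
Proof. by move=> uv vw x; exact: le_trans (vw x). Qed.

Definition monotone_segment (f : R -> R) a s :=
  {in a :: s, forall c, f a <= f c <= f (last a s)} \/
  {in a :: s, forall c, f (last a s) <= f c <= f a}.

Lemma flow_along_sandwich f a s u : BUC u -> monotone_segment f a s ->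
  flow_along S f a s u = S (f (last a s) - f a) u.
Proof.
move=> Bu [fs|fs].
  apply: (@flow_along_increasing _ _ S BUC hjS_BUC fun_le) => //.
  - by move=> v x.
  - exact: fun_le_trans.
  - exact: fun_le_anti.
  - exact: hjS0.
  - exact: hjSD.
  - exact: hjS_mono.
  - exact: hjS_down_up.
  - exact: hjS_up_down.
rewrite flow_along_negate.
rewrite (@flow_along_increasing _ _ (fun t => S (- t)) BUC
   (fun t u => @hjS_BUC (- t) u) (fun u v => fun_le v u)) //.
- by congr (S _ u); ring.
- by move=> v x.
- by move=> v w z vw wz; exact: fun_le_trans vw.
- by move=> v w vw wv; exact: fun_le_anti.
- by move=> v Bv; rewrite oppr0 hjS0.
- by move=> s' t v s0 t0 Bv; rewrite hjSD_neg.
- by move=> t v w Bv Bw vw; exact: hjS_mono.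
- by move=> t v t0 Bv; rewrite opprK; exact: hjS_up_down.
- by move=> t v t0 Bv; rewrite opprK; exact: hjS_down_up.
- by move=> c /fs/andP[fc1 fc2]; rewrite !lerN2 fc1 fc2.
Qed.

Variable L : R.
Hypotheses (L_ge0 : 0 <= L) (H_lipschitz : lipschitz_in_p L H).

(** The control formulas only involve points y at distance at most L |t|, the
    action to the other points being +oo. *)
Lemma hjS_le_near t u v x (r : R) : BUC u -> BUC v -> 
  (forall y, enorm (y - x) < r + L * `|t| -> u y = v y) ->
  forall y, enorm (y - x) < r -> S t u y <= S t v y.
Proof.
move=> Bu Bv uv y yr; rewrite -lee_fin.
have far z t' : 0 < t' -> `|t'| = `|t| -> (u z = v z) \/ (L * t' < enorm (z - y)).
  move=> t'0 tt'; case: (ltP (L * t') (enorm (z - y))) => [|zy]; first by right.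
  left; apply: uv; rewrite -tt' (gtr0_norm t'0) (_ : z - x = (y - x) + (z - y)).
    by apply: le_lt_trans (enormD _ _) _; rewrite ltr_leD.
  by rewrite [RHS]addrC subrKA.
have [t0|t0|t0] := ltgtP t 0; last first.
- by rewrite t0 !hjS0// lee_fin uv// t0 normr0 mulr0 addr0.
- apply: hjS_le => // z; case: (far z t t0 erefl) => [->|zy]; first exact: hjS_ubound.
  by rewrite (min_action_pinfty L_ge0 H_lipschitz t0 zy (min_action_gtNy _ _ t0)) addeNy leNye.
- have t'0 : 0 < - t by rewrite oppr_gt0.
  rewrite -[t]opprK; apply: hjS_ge => // z.
  case: (far z (- t) t'0 (normrN t)) => [<-|zy]; first exact: hjS_lbound.
  rewrite (min_action_pinfty L_ge0 H_lipschitz t'0 _ (min_action_gtNy _ _ t'0)) ?addey ?leey//.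
  by rewrite -enormN opprB.
Qed.

Fixpoint path_variation (f : R -> R) (a : R) (s : seq R) : R :=
  if s is b :: s' then `|f b - f a| + path_variation f b s' else 0.

Lemma flow_along_eq_near f a s u v x (r : R) : BUC u -> BUC v ->
  (forall y, enorm (y - x) < r + L * path_variation f a s -> u y = v y) ->
  forall y, enorm (y - x) < r -> flow_along S f a s u y = flow_along S f a s v y.
Proof.
elim: s a u v => [|b s IH] a u v Bu Bv /= uv.
  by move=> y yr; apply: uv; rewrite mulr0 addr0.
apply: IH; [exact: hjS_BUC|exact: hjS_BUC|move=> y yr].
rewrite mulrDr [L * _ + _]addrC addrA in uv.
apply/eqP; rewrite eq_le; apply/andP; split; apply: (hjS_le_near _ _ _ yr) => // z zr.
by symmetry; exact: uv.
Qed.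

End SolutionOperators.

(** * Extremal times of the path *)

Section Extrema.
Context {R : realType}.
Implicit Types (xi : R -> R) (T : R).

Lemma itv_uniform_continuity xi T : {within `[0, T], continuous xi} ->
  forall e, 0 < e -> exists2 r, 0 < r & forall x y, 0 <= x <= T -> 0 <= y <= T ->
    `|x - y| < r -> `|xi x - xi y| < e.
Proof.
move=> cxi e e0.
have cK : compact `[0, T]%classic by exact: segment_compact.
pose P (r x : R) := 0 <= x <= T -> forall y, 0 <= y <= T -> `|x - y| < r -> `|xi x - xi y| < e.
have : \forall r \near (0 : R)^'+, `[0, T]%classic `<=` P r.
  move/compact_near_coveringP : cK; apply => x /= xT.
  have xT' : 0 <= x <= T by rewrite in_itv/= in xT.
  have /cvgrPdist_lt cx : xi @ within `[0, T]%classic (nbhs x) --> xi x.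
    by move/subspace_continuousP : cxi; apply.
  have e2 : 0 < e / 2 by rewrite divr_gt0.
  have [r /= r0 rP] := cx _ e2.
  exists (ball x (r / 2), [set s | s < r / 2]) => /=.
    split; first by apply: nbhsx_ballx; rewrite divr_gt0.
    by apply: nbhs_right_lt; rewrite divr_gt0.
  move=> [y s] /= [xy sr] yT z zT yz.
  have H1 : `|xi x - xi y| < e / 2.
    apply: rP; last by rewrite /= in_itv.
    by rewrite /ball/= in xy *; apply: lt_trans xy _; lra.
  have H2 : `|xi x - xi z| < e / 2.
    apply: rP; last by rewrite /= in_itv.
    rewrite /ball/= in xy *.
    rewrite (_ : x - z = (x - y) + (y - z)); last by ring.
    apply: le_lt_trans (ler_normD _ _) _; lra.
  rewrite (_ : xi y - xi z = (xi x - xi z) - (xi x - xi y)); last by ring.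
  by apply: le_lt_trans (ler_normB _ _) _; lra.
move=> H.
have [r [/= r0 rP]] : exists r : R, 0 < r /\ `[0, T]%classic `<=` P r.
  near (0 : R)^'+ => r; exists r; split => //.
  by near: r.
by exists r => // x y xT yT xy; apply: (rP x) => //=; rewrite in_itv.
Unshelve. all: by end_near. Qed.

Lemma argmaxN xi a b : argmax (\- xi) a b = argmin xi a b.
Proof. by apply/seteqP; split => t [tab tm]; split => // s /tm; rewrite lerN2. Qed.

Lemma within_continuousN xi T : {within `[0, T], continuous xi} ->
  {within `[0, T], continuous (\- xi)}.
Proof. by move=> cxi x; apply: cvgN; exact: cxi. Qed.

Lemma within_continuousS xi T a b : 0 <= a -> b <= T -> {within `[0, T], continuous xi} ->
  {within `[a, b], continuous xi}.
Proof.
move=> a0 bT; apply: continuous_subspaceW => x /=; rewrite !in_itv/=.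
by move=> /andP[ax xb]; rewrite (le_trans a0 ax) (le_trans xb bT).
Qed.

Lemma argmax_neq0 xi T a b : {within `[0, T], continuous xi} -> 0 <= a -> a <= b -> b <= T ->
  argmax xi a b !=set0.
Proof.
move=> cxi a0 ab bT.
have [c cab cmax] := EVT_max ab (within_continuousS a0 bT cxi).
rewrite in_itv/= in cab; by exists c; split => // s; exact: cmax.
Qed.

(** If the supremum were not itself a maximum point, continuity would exclude
    maximum points near it. *)
Lemma sup_argmax xi T a b : {within `[0, T], continuous xi} -> 0 <= a -> a <= b -> b <= T ->
  argmax xi a b (sup (argmax xi a b)).
Proof.
move=> cxi a0 ab bT; have [c cm] := argmax_neq0 cxi a0 ab bT.
set A := argmax xi a b in cm *.
have hA : has_sup A by split; [exists c|exists b => t [/andP[]]].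
have sc : c <= sup A by exact: sup_upper_bound.
have sb : sup A <= b by apply: ge_sup; [exists c|move=> t [/andP[]]].
have [/andP[ac cb] cmax] := cm.
have sab : a <= sup A <= b by rewrite sb (le_trans ac sc).
split => // s ssab; rewrite leNgt; apply/negP => lt.
have e0 : 0 < xi s - xi (sup A) by rewrite subr_gt0.
have [r r0 rP] := itv_uniform_continuity cxi e0.
have [t At tr] := sup_adherent r0 hA.
have ts : t <= sup A by exact: sup_upper_bound.
have [/andP[at_ tb] tmax] := At.
have : `|xi t - xi (sup A)| < xi s - xi (sup A).
  by apply: rP; [lra|lra|rewrite ltr_norml; lra].
by have := tmax _ ssab; rewrite ltr_norml; lra.
Qed.

Lemma inf_argmax xi T a b : {within `[0, T], continuous xi} -> 0 <= a -> a <= b -> b <= T ->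
  argmax xi a b (inf (argmax xi a b)).
Proof.
move=> cxi a0 ab bT; have [c cm] := argmax_neq0 cxi a0 ab bT.
set A := argmax xi a b in cm *.
have hA : has_inf A by split; [exists c|exists a => t [/andP[]]].
have sc : inf A <= c by apply: ge_inf => //; case: hA.
have sb : a <= inf A by apply: lb_le_inf; [exists c|move=> t [/andP[]]].
have [/andP[ac cb] cmax] := cm.
have sab : a <= inf A <= b by rewrite sb (le_trans sc cb).
split => // s ssab; rewrite leNgt; apply/negP => lt.
have e0 : 0 < xi s - xi (inf A) by rewrite subr_gt0.
have [r r0 rP] := itv_uniform_continuity cxi e0.
have [t At tr] := inf_adherent r0 hA.
have ts : inf A <= t by apply: ge_inf => //; case: hA.
have [/andP[at_ tb] tmax] := At.
have : `|xi t - xi (inf A)| < xi s - xi (inf A).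
  by apply: rP; [lra|lra|rewrite ltr_norml; lra].
by have := tmax _ ssab; rewrite ltr_norml; lra.
Qed.

Lemma sup_argmin xi T a b : {within `[0, T], continuous xi} -> 0 <= a -> a <= b -> b <= T ->
  argmin xi a b (sup (argmin xi a b)).
Proof. by rewrite -argmaxN => cxi; apply: sup_argmax; exact: within_continuousN. Qed.

Lemma inf_argmin xi T a b : {within `[0, T], continuous xi} -> 0 <= a -> a <= b -> b <= T ->
  argmin xi a b (inf (argmin xi a b)).
Proof. by rewrite -argmaxN => cxi; apply: inf_argmax; exact: within_continuousN. Qed.

(** The points p and q need not be the ends of [a, b], nor lie in it: an
    oscillation bound is wanted on [tau_i, T] in terms of tau_{i+1}. *)
Definition between xi p q a b :=
  (forall t, a <= t <= b -> xi p <= xi t <= xi q) \/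
  (forall t, a <= t <= b -> xi q <= xi t <= xi p).

Lemma between_sym xi p q a b : between xi p q a b -> between xi q p a b.
Proof. by case; [right|left]. Qed.

Lemma between_sub xi p q a b a' b' : a <= a' -> b' <= b ->
  between xi p q a b -> between xi p q a' b'.
Proof.
move=> aa bb; case=> H; [left|right] => t /andP[ta tb]; apply: H;
  by rewrite (le_trans aa ta) (le_trans tb bb).
Qed.

Lemma between_osc xi p q a b : between xi p q a b ->
  forall x y, a <= x <= b -> a <= y <= b -> `|xi x - xi y| <= `|xi q - xi p|.
Proof.
move=> [] H x y /H/andP[x1 x2] /H/andP[y1 y2].
  by rewrite [leRHS]ger0_norm ?ler_norml; lra.
by rewrite [leRHS]ler0_norm ?ler_norml; lra.
Qed.

(** By induction tau_n is an extremum of xi over [tau_n, T], and tau_{n+1} is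
    by definition an extremum of the other type. *)
Lemma reduction_times_forward xi T tau maxt : {within `[0, T], continuous xi} ->
  reduction_times xi T tau maxt -> forall n : nat,
  [/\ 0 <= tau n%:Z, tau n%:Z <= tau (n%:Z + 1), tau (n%:Z + 1) <= T &
      between xi (tau n%:Z) (tau (n%:Z + 1)) (tau n%:Z) T].
Proof.
move=> cxi [_ tau0 tauS _].
pose ext b a t := if b then argmax xi a T t else argmin xi a T t.
have step n : 0 <= tau n%:Z -> ext (maxt n%:Z) (tau n%:Z) (tau n%:Z) ->
    ext (~~ maxt n%:Z) (tau n%:Z) (tau (n%:Z + 1)).
  move=> tn0 extn.
  have tnT : tau n%:Z <= T.
    by move: extn; rewrite /ext; case: ifP => _ [/andP[]].
  have [_ ->] := tauS n%:Z isT; rewrite /ext; case: (maxt n%:Z) => /=.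
    exact: sup_argmin cxi _ _ _.
  exact: sup_argmax cxi _ _ _.
have extS b a a' t : a <= a' -> a' <= t -> ext b a t -> ext b a' t.
  move=> aa a't; rewrite /ext; case: b => -[/andP[at_ tT] H];
  split; rewrite ?a't// => s /andP[s1 s2];
  by apply: H; rewrite (le_trans aa s1).
have main n : 0 <= tau n%:Z /\ ext (maxt n%:Z) (tau n%:Z) (tau n%:Z).
  elim: n => [|n [tn0 extn]].
    have t0 : 0 <= tau 0 by move: tau0; case: ifP => _ [/andP[]].
    split => //; apply: (extS _ 0) => //.
    by move: tau0; rewrite /ext; case: ifP.
  have := step n tn0 extn; rewrite -PoszD addn1 => extSn.
  have tt : tau n%:Z <= tau n.+1%:Z by move: extSn; rewrite /ext; case: ifP => _ [/andP[]].
  split; first exact: le_trans tt.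
  have [E _] := tauS n%:Z isT; rewrite -PoszD addn1 in E; rewrite E.
  exact: extS extSn.
move=> n; have [tn0 extn] := main n; have extSn := step n tn0 extn.
split => //.
- by move: extSn; rewrite /ext; case: ifP => _ [/andP[]].
- by move: extSn; rewrite /ext; case: ifP => _ [/andP[]].
move: extn extSn; rewrite /ext; case: (maxt n%:Z) => /= -[_ H1] [_ H2].
  by right => t tT; rewrite H1// H2.
by left => t tT; rewrite H1// H2.
Qed.

Lemma reduction_times_backward xi T tau maxt : {within `[0, T], continuous xi} ->
  reduction_times xi T tau maxt -> forall n : nat,
  [/\ 0 <= tau (- n%:Z - 1), tau (- n%:Z - 1) <= tau (- n%:Z), tau (- n%:Z) <= T &
      between xi (tau (- n%:Z)) (tau (- n%:Z - 1)) 0 (tau (- n%:Z))].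
Proof.
move=> cxi [_ tau0 _ tauS].
pose ext b a t := if b then argmax xi 0 a t else argmin xi 0 a t.
have step n : tau (- n%:Z) <= T -> ext (maxt (- n%:Z)) (tau (- n%:Z)) (tau (- n%:Z)) ->
    ext (~~ maxt (- n%:Z)) (tau (- n%:Z)) (tau (- n%:Z - 1)).
  move=> tnT extn.
  have tn0 : 0 <= tau (- n%:Z).
    by move: extn; rewrite /ext; case: ifP => _ [/andP[]].
  have n0 : - n%:Z <= 0 by rewrite oppr_le0.
  have [_ ->] := tauS (- n%:Z) n0; rewrite /ext; case: (maxt (- n%:Z)) => /=.
    exact: inf_argmin cxi _ _ _.
  exact: inf_argmax cxi _ _ _.
have extS b a a' t : a' <= a -> t <= a' -> ext b a t -> ext b a' t.
  move=> aa a't; rewrite /ext; case: b => -[/andP[at_ tT] H];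
  split; rewrite ?a't ?at_// => s /andP[s1 s2];
  by apply: H; rewrite s1 (le_trans s2 aa).
have main n : tau (- n%:Z) <= T /\ ext (maxt (- n%:Z)) (tau (- n%:Z)) (tau (- n%:Z)).
  elim: n => [|n [tn0 extn]].
    rewrite oppr0.
    have t0 : tau 0 <= T by move: tau0; case: ifP => _ [/andP[]].
    split => //; apply: (extS _ T) => //.
    by move: tau0; rewrite /ext; case: ifP.
  have nE : - n.+1%:Z = - n%:Z - 1 by rewrite -addn1 PoszD opprD.
  have := step n tn0 extn; rewrite -nE => extSn.
  have tt : tau (- n.+1%:Z) <= tau (- n%:Z) by move: extSn; rewrite /ext; case: ifP => _ [/andP[]].
  split; first exact: le_trans tn0.
  have n0 : - n%:Z <= 0 by rewrite oppr_le0.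
  have [E _] := tauS (- n%:Z) n0; rewrite nE E -nE.
  exact: extS extSn.
move=> n; have [tn0 extn] := main n; have extSn := step n tn0 extn.
split => //.
- by move: extSn; rewrite /ext; case: ifP => _ [/andP[]].
- by move: extSn; rewrite /ext; case: ifP => _ [/andP[]].
move: extn extSn; rewrite /ext; case: (maxt (- n%:Z)) => /= -[_ H1] [_ H2].
  by right => t tT; rewrite H1// H2.
by left => t tT; rewrite H1// H2.
Qed.

(** The sequence would otherwise grow linearly. *)
Lemma bounded_sequence_small_step (x : nat -> R) (M r : R) : 0 < r ->
  (forall n, 0 <= x n <= M) -> exists n, x n.+1 - x n < r.
Proof.
move=> r0 xM; apply: contrapT => H.
have step n : r <= x n.+1 - x n by rewrite leNgt; apply/negP => h; apply: H; exists n.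
have grow n : n%:R * r <= x n.
  elim: n => [|n IH]; first by rewrite mul0r; have /andP[] := xM 0%N.
  rewrite -addn1 natrD mulrDl mul1r addn1; have := step n; lra.
have := grow (Num.bound (M / r)); have /andP[_ h] := xM (Num.bound (M / r)).
have : M / r < (Num.bound (M / r))%:R.
  apply: archi_boundP; apply: divr_ge0; last exact: ltW.
  by have /andP[x0 x0M] := xM 0%N; exact: le_trans x0M.
rewrite ltr_pdivrMr//; lra.
Qed.

End Extrema.

(** * Piecewise linear interpolation *)

Section Interpolation.
Context {R : realType}.
Implicit Types (xi : R -> R) (a b e : R) (s : seq R).

Lemma path_le_last a s : path <=%R a s -> a <= last a s.
Proof. by elim: s a => //= b s IH a /andP[ab /IH]; exact: le_trans. Qed.

Lemma path_le_mem a s c : path <=%R a s -> c \in a :: s -> a <= c <= last a s.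
Proof.
elim: s a => [|b s IH] a /=; first by rewrite inE => _ /eqP ->; rewrite lexx.
move=> /andP[ab pb]; rewrite inE => /predU1P[->|/(IH _ pb)/andP[bc ->]].
  by rewrite lexx (le_trans ab)//; exact: path_le_last.
by rewrite (le_trans ab).
Qed.

Fixpoint fine_cells xi e a s : Prop :=
  if s is b :: s' then
    (forall x y, a <= x <= b -> a <= y <= b -> `|xi x - xi y| <= e) /\
    fine_cells xi e b s'
  else True.

Lemma fine_cells_cat xi e a s s' :
  fine_cells xi e a s -> fine_cells xi e (last a s) s' -> fine_cells xi e a (s ++ s').
Proof. by elim: s a => //= b s IH a [? ?] ?; split => //; exact: IH. Qed.

(** Steps of half a modulus of continuity reach b after finitely many
    nodes. *)
Lemma fine_cells_exist xi T e a b : {within `[0, T], continuous xi} -> 0 < e ->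
  0 <= a -> a <= b -> b <= T ->
  exists s, [/\ path <=%R a s, last a s = b & fine_cells xi e a s].
Proof.
move=> cxi e0 a0 ab bT; have [r r0 rP] := itv_uniform_continuity cxi e0.
have [n bn] : exists n : nat, b - a <= n%:R * (r / 2).
  exists (Num.bound ((b - a) / (r / 2))); rewrite -ler_pdivrMr ?divr_gt0//.
  by apply/ltW/archi_boundP; rewrite divr_ge0 ?subr_ge0// ltW// divr_gt0.
have cell p q : 0 <= p -> q <= T -> q - p < r ->
    forall x y, p <= x <= q -> p <= y <= q -> `|xi x - xi y| <= e.
  move=> p0 qT pq x y xpq ypq; apply/ltW/rP; [lra|lra|].
  by rewrite ltr_norml; lra.
elim: n a a0 ab bn => [|n IH] a a0 ab bn.
  have -> : b = a by lra.
  by exists [::].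
have [ba|ba] := ltP (b - a) r.
  by exists [:: b]; split => //=; [rewrite ab|split => //; exact: cell].
have a0' : 0 <= a + r / 2 by lra.
have ab' : a + r / 2 <= b by lra.
have bn' : b - (a + r / 2) <= n%:R * (r / 2).
  by rewrite -addn1 natrD mulrDl in bn; lra.
have [s [ps ls fs]] := IH (a + r / 2) a0' ab' bn'.
exists (a + r / 2 :: s); split => //=.
  by rewrite ps andbT; lra.
by split => //; apply: cell; lra.
Qed.

(** Repeated nodes are allowed: in a cell with a = b the slope is 0, as
    division by 0 gives 0, and the value is xi a. *)
Fixpoint interpolation xi a s (t : R) : R :=
  if s is b :: s' then
    if t <= b then xi a + (t - a) / (b - a) * (xi b - xi a)
    else interpolation xi b s' t
  else xi a.

Lemma interpolation_left xi a s : path <=%R a s -> interpolation xi a s a = xi a.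
Proof. by case: s => //= b s /andP[-> _]; rewrite subrr !mul0r addr0. Qed.

Lemma interpolation_first xi a b s : interpolation xi a (b :: s) b = xi b.
Proof.
rewrite /= lexx; have [->|ab] := eqVneq a b; first by rewrite subrr !mul0r addr0.
by rewrite divff ?subr_eq0 1?eq_sym// mul1r addrC subrK.
Qed.

Lemma interpolation_tail xi a b s t : path <=%R b s -> b <= t ->
  interpolation xi a (b :: s) t = interpolation xi b s t.
Proof.
move=> pb; rewrite le_eqVlt => /predU1P[<-|bt].
  by rewrite interpolation_first interpolation_left.
by rewrite /= leNgt bt.
Qed.

Lemma interpolation_node xi a s c : path <=%R a s -> c \in a :: s ->
  interpolation xi a s c = xi c.
Proof.
elim: s a => [|b s IH] a pa; first by rewrite inE => /eqP ->.
have /andP[ab pb] : (a <= b) && path <=%R b s by [].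
rewrite inE => /predU1P[->|cb]; first exact: interpolation_left.
have /andP[bc _] := path_le_mem pb cb.
by rewrite interpolation_tail// IH.
Qed.

Lemma eq_affine_along f g a s : path <=%R a s ->
  (forall t, a <= t -> f t = g t) -> affine_along f a s -> affine_along g a s.
Proof.
elim: s a => //= b s IH a /andP[ab pb] fg [fab fbs]; split.
  move=> t /andP[at_ tb]; rewrite -!fg//; apply: fab; by rewrite at_ tb.
by apply: IH fbs => // t bt; apply: fg; exact: le_trans bt.
Qed.

Lemma interpolation_affine xi a s : path <=%R a s ->
  affine_along (interpolation xi a s) a s.
Proof.
elim: s a => [//|b s IH] a pa.
have /andP[ab pb] : (a <= b) && path <=%R b s by [].
split; last first.
  by apply: eq_affine_along (IH _ pb) => // t bt; rewrite interpolation_tail.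
move=> t /andP[at_ tb].
rewrite interpolation_first interpolation_left//= tb.
have [E|ab'] := eqVneq a b; last by field; rewrite subr_eq0 eq_sym.
rewrite -E in tb *; have -> : t = a by lra.
by rewrite !subrr !mul0r addr0.
Qed.

Lemma interpolation_close xi e a s t : 0 <= e -> path <=%R a s -> fine_cells xi e a s ->
  a <= t <= last a s -> `|xi t - interpolation xi a s t| <= e.
Proof.
move=> e0; elim: s a => [|b s IH] a.
  by move=> _ _ /= tt; have -> : t = a by [lra]; rewrite subrr normr0.
move=> pa fa; have /andP[ab pb] : (a <= b) && path <=%R b s by [].
case: fa => fab fb /andP[at_ tl].
have [tb|bt] := leP t b; last first.
  rewrite interpolation_tail//; last exact: ltW.
  by apply: IH => //; rewrite (ltW bt).
rewrite /= tb.
set m := (t - a) / (b - a).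
have m01 : 0 <= m <= 1.
  have [E|ab'] := eqVneq a b.
    rewrite -E in tb; have -> : m = 0; last by rewrite lexx ler01.
    by rewrite /m; have -> : t = a by [lra]; rewrite !subrr mul0r.
  have ba : 0 < b - a by rewrite subr_gt0 lt_neqAle ab'.
  by rewrite /m divr_ge0 ?subr_ge0//= ler_pdivrMr// mul1r lerD2r.
have := fab t a; have := fab t b; rewrite !lexx ab tb at_ => /(_ isT isT) + /(_ isT isT).
rewrite !ler_norml => h1 h2.
nra.
Qed.

Lemma eq_path_variation f g a s : {in a :: s, f =1 g} ->
  path_variation f a s = path_variation g a s.
Proof.
elim: s a => //= b s IH a fg; rewrite !fg ?inE ?eqxx ?orbT// (IH b)//.
by move=> c cs; apply: fg; rewrite inE cs orbT.
Qed.

Lemma path_variation_le f a s : path <=%R a s ->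
  ((path_variation f a s)%:E <= total_variation a (last a s) f)%E.
Proof.
elim: s a => [|b s IH] a /=; first by rewrite total_variationxx.
move=> /andP[ab pb]; rewrite (total_variationD f ab (path_le_last pb)) EFinD.
by apply: leeD; [exact: total_variation_ge|exact: IH].
Qed.

End Interpolation.

(** * Replacing the path by its reduced path *)

Section Reduction.
Context {R : realType} {d : nat}.
Implicit Types (xi r : R -> R) (T e a b : R).
Notation E := 'rV[R]_d.
Variables (H : E -> E -> R).
Hypotheses (H_wp : well_posed H) (negH_wp : well_posed (negH H))
    (H_control : control_representation H).
Local Notation S := (hjS H).

(** The list s is a fine mesh of [a, b], used to approximate xi uniformly; the
    list c, on which xi and its reduced path r agree, gives the same flow with
    few steps, hence a small propagation range. *)
Definition reducible (xi r : R -> R) e a b := exists s c,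
  [/\ path <=%R a s /\ path <=%R a c, last a s = b /\ last a c = b,
      fine_cells xi e a s, {in a :: c, xi =1 r} &
      forall u : E -> R, BUC u -> flow_along S xi a s u = flow_along S xi a c u].

Lemma reducible_trans xi r e a b c : reducible xi r e a b -> reducible xi r e b c ->
  reducible xi r e a c.
Proof.
move=> [s [s' [[ps ps'] [ls ls'] fs rs' fl]]] [t [t' [[pt pt'] [lt lt'] ft rt' flt]]].
exists (s ++ t), (s' ++ t'); split.
- by rewrite !cat_path ps ps' ls ls' pt pt'.
- by rewrite !last_cat ls ls' lt lt'.
- by apply: fine_cells_cat => //; rewrite ls.
- move=> x; rewrite -cat_cons mem_cat => /orP[/rs'//|xt']; apply: rt'.
  by rewrite inE xt' orbT.
- move=> u Bu; rewrite !flow_along_cat ls ls' fl// flt//.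
  by apply: flow_along_B => // t0 v; exact: hjS_BUC.
Qed.

Lemma reducible_short xi r e a b : a <= b -> xi a = r a -> xi b = r b ->
  (forall x y, a <= x <= b -> a <= y <= b -> `|xi x - xi y| <= e) ->
  reducible xi r e a b.
Proof.
move=> ab ra rb osc; exists [:: b], [:: b]; split => //=; rewrite ?ab//.
by move=> c; rewrite !inE => /orP[] /eqP ->.
Qed.

Lemma reducible_between xi r T e a b : {within `[0, T], continuous xi} -> 0 < e ->
  0 <= a -> a <= b -> b <= T -> xi a = r a -> xi b = r b ->
  between xi a b a b -> reducible xi r e a b.
Proof.
move=> cxi e0 a0 ab bT ra rb xiab.
have [s [ps ls fs]] := fine_cells_exist cxi e0 a0 ab bT.
exists s, [:: b]; split => //=; rewrite ?ab//.
  by move=> c; rewrite !inE => /orP[] /eqP ->.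
move=> u Bu; rewrite (flow_along_sandwich H_wp negH_wp H_control Bu) ?ls//.
case: xiab => H0; [left|right] => c /(path_le_mem ps); rewrite ls; exact: H0.
Qed.

(** [0, T] is cut at tau_{-M}, ..., tau_N.  The middle cells are reducible
    because xi stays between its end values there; the first and the last one
    because they have small oscillation and need no refinement. *)
Lemma reduction_reducible xi r T e : 0 < T -> {within `[0, T], continuous xi} ->
  is_reduced_path xi T r -> 0 < e -> reducible xi r e 0 T.
Proof.
move=> T0 cxi [tau [maxt [rt _ [r0 rT] rtau]]] e0.
have fwd := reduction_times_forward cxi rt.
have bwd := reduction_times_backward cxi rt.
have rE i : xi (tau i) = r (tau i) by case: (rtau i).
have [dl dl0 dlP] := itv_uniform_continuity cxi e0.
have [N Nd] : exists N : nat, tau N.+1 - tau N < dl.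
  apply: (bounded_sequence_small_step (M := T) (x := fun n : nat => tau n)) => // n.
  have [t0 t1 t2 _] := fwd n; lra.
have [M Md] : exists M : nat, tau (- M%:Z) - tau (- M%:Z - 1) < dl.
  have [n|n nd] := bounded_sequence_small_step (M := T)
    (x := fun n : nat => T - tau (- n%:Z)) dl0.
    have [t0 t1 t2 _] := bwd n; lra.
  exists n; rewrite (_ : - n.+1%:Z = - n%:Z - 1) in nd; first lra.
  by rewrite -addn1 PoszD opprD.
have red_fwd (n : nat) : reducible xi r e (tau 0) (tau n).
  elim: n => [|n IH].
    apply: reducible_short => // x y; have [h1 h2 h3 _] := fwd 0%N.
    move=> hx hy; rewrite (_ : x = y) ?subrr ?normr0 ?ltW//; lra.
  apply: reducible_trans IH _; rewrite (_ : n.+1%:Z = n%:Z + 1); last by rewrite -PoszD addn1.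
  have [h1 h2 h3 h4] := fwd n.
  by apply: (reducible_between cxi) => //; exact: between_sub h4.
have red_bwd (n : nat) : reducible xi r e (tau (- n%:Z)) (tau 0).
  elim: n => [|n IH]; first exact: (red_fwd 0%N).
  apply: reducible_trans IH; rewrite (_ : - n.+1%:Z = - n%:Z - 1); last first.
    by rewrite -addn1 PoszD opprD.
  have [h1 h2 h3 h4] := bwd n.
  apply: (reducible_between cxi) => //; apply: between_sym.
  exact: between_sub h4.
have [f1 f2 f3 f4] := fwd N; have [b1 b2 b3 b4] := bwd M.
apply: (@reducible_trans _ _ _ _ (tau (- M%:Z))).
  apply: reducible_short => //; first exact: le_trans b2.
  move=> x y hx hy; apply: le_trans (between_osc b4 hx hy) _.
  apply/ltW/dlP; [lra|lra|]; rewrite ltr_norml; lra.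
apply: reducible_trans (red_bwd M) _; apply: reducible_trans (red_fwd N) _.
apply: reducible_short => //; first exact: le_trans f3.
move=> x y hx hy; apply: le_trans (between_osc f4 hx hy) _.
have NE : N.+1%:Z = N%:Z + 1 by rewrite -PoszD addn1.
rewrite NE in Nd.
by apply/ltW/dlP; [lra|lra|]; rewrite ltr_norml; lra.
Qed.

(** The interpolations of xi at the nodes s n are admissible approximations in
    the definition of the flow, and only their values at the nodes enter. *)
Lemma is_flow_interpolation xi T u v (s : nat -> seq R) : 0 <= T ->
  is_flow H xi T u v ->
  (forall n, [/\ path <=%R 0 (s n), last 0 (s n) = T & fine_cells xi n.+1%:R^-1 0 (s n)]) ->
  forall x e, 0 < e -> \forall n \near \oo,
    `|v x - flow_along S xi 0 (s n) u x| < e.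
Proof.
move=> T0 fl sP x e e0.
have h := fl (fun n => interpolation xi 0 (s n)) s.
have h1 n : partition_of T (s n) /\ affine_along (interpolation xi 0 (s n)) 0 (s n).
  have [ps ls _] := sP n; rewrite /partition_of ps ls eqxx; split => //.
  exact: interpolation_affine.
have h2 : {uniform `[0, T], (fun n => interpolation xi 0 (s n)) @ \oo --> xi}.
  move=> P /= /uniform_nbhs [F [entF FP]].
  move: entF; rewrite -entourage_ballE => -[e' /= e'0 eF].
  near=> n; apply: FP => t; rewrite /= in_itv/= => tT; apply: eF => /=.
  have [ps ls fs] := sP n.
  rewrite /ball/=; apply: le_lt_trans (interpolation_close _ ps fs _) _ => //.
    by rewrite ls.
  near: n; exact: near_infty_natSinv_lt (PosNum e'0).
have := h h1 h2 [set g : E -> R | `|v x - g x| < e].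
rewrite /= => hh.
have : nbhs (v : {uniform E -> R}) [set g : E -> R | `|v x - g x| < e].
  apply/uniform_nbhs; exists [set p | ball p.1 e p.2]; split.
    by rewrite -entourage_ballE; exists e.
  by move=> g /(_ x I).
move/hh; apply: filterS => n /=.
rewrite pl_flowE (@eq_flow_along _ _ S _ xi)//.
by move=> c cs; apply: interpolation_node => //; have [] := sP n.
Unshelve. all: by end_near. Qed.

End Reduction.

Theorem theorem1p2 (R : realType) (d : nat)
    (H : 'rV[R]_d -> 'rV[R]_d -> R) (L : R)
    (L_ge0 : 0 <= L)
    (H_convex : convex_in_p H)
    (H_lipschitz : lipschitz_in_p L H)
    (H_wp : well_posed H) (negH_wp : well_posed (negH H))
    (H_control : control_representation H)
    (H_action : action_assumption H) :
  forall T : R, 0 < T ->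
  forall xi : R -> R, {within `[0, T], continuous xi} -> xi 0 = 0 ->
  forall r : R -> R, is_reduced_path xi T r ->
    (range_of_dependence H xi T <= L%:E * total_variation 0 T r)%E.
Proof.
move=> T T0 xi cxi _ r rP; apply: ge_ereal_sup => _ [->|[r0 [r00 [u1 [u2 [x sol]]]] <-]].
  by rewrite mule_ge0// ?lee_fin// total_variation_ge0// ltW.
have [[B1 f1] [B2 f2] u12 neq] := sol; rewrite leNgt; apply/negP => small.
apply: neq; apply/eqP/negPn/negP => neq.
have inv_gt0 n : (0 : R) < n.+1%:R^-1 by rewrite invr_gt0.
have /choice[s /choice[c sP]] n :=
  reduction_reducible H_wp negH_wp H_control T0 cxi rP (inv_gt0 n).
have TT : 0 <= T <= T by rewrite lexx ltW.
have sP' n : [/\ path <=%R 0 (s n), last 0 (s n) = T & fine_cells xi n.+1%:R^-1 0 (s n)].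
  by case: (sP n) => -[? ?] [? ?].
(* the flow along c n has range at most L times the variation of r *)
have flow12 n : flow_along (hjS H) xi 0 (s n) (fun x => u1 (x, 0)) x =
    flow_along (hjS H) xi 0 (s n) (fun x => u2 (x, 0)) x.
  have [[_ pc] [_ lc] _ rc fl] := sP n; rewrite !fl//.
  have var_le : L * path_variation xi 0 (c n) < r0.
    rewrite -lte_fin; apply: le_lt_trans small.
    rewrite (eq_path_variation rc) EFinM; apply: lee_wpmul2l; first by rewrite lee_fin.
    by rewrite -[in X in (_ <= X)%E]lc; exact: path_variation_le.
  have near y : enorm (y - x) < r0 - L * path_variation xi 0 (c n) +
      L * path_variation xi 0 (c n) -> u1 (y, 0) = u2 (y, 0).
    by rewrite subrK; exact: u12.
  apply: (flow_along_eq_near H_wp negH_wp H_control L_ge0 H_lipschitz B1 B2 near).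
  by rewrite subrr enorm0 subr_gt0.
(* half of the gap between the two solutions at (x, T): both are within e of
   the same value of the approximate flow *)
pose e := `|u1 (x, T) - u2 (x, T)| / 2.
have e0 : 0 < e by rewrite divr_gt0// normr_gt0 subr_eq0.
have [n [n1 n2]] : exists n,
    `|u1 (x, T) - flow_along (hjS H) xi 0 (s n) (fun x => u1 (x, 0)) x| < e /\
    `|u2 (x, T) - flow_along (hjS H) xi 0 (s n) (fun x => u2 (x, 0)) x| < e.
  near \oo => n; exists n; split; near: n.
    exact: (is_flow_interpolation (ltW T0) (f1 T TT) sP').
  exact: (is_flow_interpolation (ltW T0) (f2 T TT) sP').
rewrite -flow12 in n2.
set w := flow_along _ _ _ _ _ _ in n1 n2.
have : `|u1 (x, T) - u2 (x, T)| < e + e.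
  rewrite (_ : _ - _ = (u1 (x, T) - w) - (u2 (x, T) - w)); last by ring.
  exact: le_lt_trans (ler_normB _ _) (ltrD n1 n2).
by rewrite /e -splitr ltxx.
Unshelve. all: by end_near. Qed.
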